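(* Let $K$ be a number field that is either a totally real cubic field or a real biquadratic field (i.e. $K=\mathbb{Q}(\sqrt{p},\sqrt{q})$ with $p,q>1$ distinct squarefree integers), and let $\mathcal{O}_K$ be its ring of integers. If $K\neq \mathbb{Q}(\zeta_7+\zeta_7^{-1})$, then there does not exist a $\mathbb{Z}$-form that is universal over $\mathcal{O}_K$.
   Context: A $\mathbb{Z}$-form is a positive definite quadratic form $Q(x_1,\dots,x_r)=\sum_{1\le i\le j\le r}a_{ij}x_ix_j$ with all $a_{ij}\in\mathbb{Z}$. For a totally real number field $K$, an element $\alpha\in\mathcal{O}_K$ is totally positive if its image under every real embedding of $K$ is positive. A $\mathbb{Z}$-form $Q$ is universal over $\mathcal{O}_K$ if for every totally positive $\alpha\in\mathcal{O}_K$ there is $v\in\mathcal{O}_K^r$ with $Q(v)=\alpha$. Here $\zeta_7$ denotes a primitive $7$th root of unity. *)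

(* Defs.v *)
From HB Require Import structures.
From mathcomp Require Import all_boot all_order all_algebra all_field.
Set Implicit Arguments. Unset Strict Implicit. Unset Printing Implicit Defensive.
Import Order.TTheory GRing.Theory Num.Theory.
Local Open Scope ring_scope.

(* A number field is modelled as a finite-dimensional field extension L of rat
   (L : fieldExtType rat); its complex embeddings are the ring morphisms
   L -> algC (these automatically fix Q). *)

Definition real_embedding (L : fieldExtType rat) (s : {rmorphism L -> algC}) : Prop :=
  forall x : L, s x \is Num.real.

Definition totally_real (L : fieldExtType rat) : Prop :=
  forall s : {rmorphism L -> algC}, real_embedding s.

Definition in_OK (L : fieldExtType rat) (x : L) : Prop :=
  exists p : {poly int}, p \is monic /\ root (map_poly (fun z : int => z%:~R : L) p) x.

Definition totally_positive (L : fieldExtType rat) (a : L) : Prop :=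
  forall s : {rmorphism L -> algC}, real_embedding s -> 0 < s a.

Definition qf_eval (R : pzRingType) (r : nat) (a : 'I_r -> 'I_r -> int)
  (v : 'I_r -> R) : R :=
  \sum_(i < r) \sum_(j < r | (i <= j)%N) (a i j)%:~R * v i * v j.

(* positive definite (over Q, equivalently over R for integral forms) *)
Definition pos_def (r : nat) (a : 'I_r -> 'I_r -> int) : Prop :=
  forall v : 'I_r -> rat, (exists i, v i != 0) -> 0 < qf_eval a v.

Definition is_Z_form (r : nat) (a : 'I_r -> 'I_r -> int) : Prop := pos_def a.

Definition universal_over (L : fieldExtType rat) (r : nat)
  (a : 'I_r -> 'I_r -> int) : Prop :=
  forall alpha : L, in_OK alpha -> totally_positive alpha ->
    exists v : 'I_r -> L, (forall i, in_OK (v i)) /\ qf_eval a v = alpha.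

Definition totally_real_cubic (L : fieldExtType rat) : Prop :=
  \dim {:L} = 3%N /\ totally_real L.

Definition squarefree (n : nat) : Prop := forall d : nat, (d ^ 2 %| n)%N -> d = 1%N.

Definition real_biquadratic (L : fieldExtType rat) : Prop :=
  exists p q : nat, [/\ (1 < p)%N, (1 < q)%N, p != q, squarefree p & squarefree q] /\
    exists a b : L, [/\ a ^+ 2 = p%:R, b ^+ 2 = q%:R & (<<1 & [:: a; b]>>%VS = fullv)].

Definition in_Q_of (c : algC) (y : algC) : Prop :=
  exists p : {poly rat}, y = (map_poly ratr p).[c].

Definition iso_Q_zeta7_plus (L : fieldExtType rat) : Prop :=
  exists z : algC, 7.-primitive_root z /\
  exists s : {rmorphism L -> algC},
    (forall x, in_Q_of (z + z^-1) (s x)) /\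
    (forall y, in_Q_of (z + z^-1) y -> exists x, s x = y).

(* Main.v *)
Require Import Defs.
From HB Require Import structures.
From mathcomp Require Import all_boot all_order all_algebra all_field.
From mathcomp Require Import ring lra zify.
From Stdlib Require Import Classical.
Set Implicit Arguments. Unset Strict Implicit. Unset Printing Implicit Defensive.
Import Order.TTheory GRing.Theory Num.Theory.
Local Open Scope ring_scope.

(** If [Q] is universal and [alpha = Q v], then the trace of [alpha] bounds a
    trace form tensored with [Q] at [v].  On the quotient of the ring of integers
    by a subring (the rational integers for a cubic field, the integers of a
    quadratic subfield for a biquadratic one) this trace form has rank two, and
    the tensor product of a binary form with an integral form has no value below
    the minimum of the binary form.  Hence, when [alpha] lies outside the subring,
    its trace is at least the minimum of the quotient form.

    For a biquadratic field an explicit [alpha = (j + sqrt n) / 2] or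
    [s + sqrt n] always violates this.  For a cubic field let [y] be an
    irrational integer minimizing the quotient form; comparing with the translates
    [n + y] and [n - y] bounds the discriminant of the minimal polynomial of [y],
    and all but the fields of discriminant 49, 81 and 148 are excluded at once.
    For the last two a sharper estimate comes from the index of [Z[y]] in the ring
    of integers; the first is the maximal real subfield of the seventh
    cyclotomic field. *)

(** Rank two is what controls the tensor product for a form [Q] in any number of variables: a
    reduced binary form is a nonnegative combination of the squares of three integral linear forms,
    and tensoring replaces each square by a value of [Q] at an integral vector, which is 0 or at
    least 1. The contradiction is then one of size: the least totally positive translate of an
    element has a trace of the order of the square root of the minimum, so only small fields can
    escape. Two refinements deal with those. In the cubic case the bound uses the second minimum,
    because positivity of [Q] keeps [n + y] and [n - y] from being represented inside Q + Q y. In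
    the biquadratic case the bound need not be strict, because equality would confine the vector to
    a plane on which [Q] takes values in the quadratic subfield. The biquadratic obstacle is the
    prime 2: denominators 2 or 4 decide the minimum, so the subfield is chosen by the residues
    modulo 4 of the three radicands. *)

(** * Values of integral quadratic forms *)

Section QuadraticForm.
Variables (r : nat) (a : 'I_r -> 'I_r -> int).

Lemma raddf_qf_eval (R S : pzRingType) (f : {additive R -> S}) (v : 'I_r -> R) :
  f (qf_eval a v) =
    \sum_(i < r) \sum_(j < r | (i <= j)%N) (a i j)%:~R * f (v i * v j).
Proof.
rewrite raddf_sum; apply: eq_bigr => i _; rewrite raddf_sum.
by apply: eq_bigr => j _; rewrite -mulrA !mulrzl raddfMz.
Qed.

Lemma qf_eval_eq (R : pzRingType) (v w : 'I_r -> R) :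
  v =1 w -> qf_eval a v = qf_eval a w.
Proof. by move=> e; do 2![apply: eq_bigr => ? _]; rewrite !e. Qed.

Lemma qf_eval_scale (v : 'I_r -> rat) (c : rat) :
  qf_eval a (fun i => c * v i) = c ^+ 2 * qf_eval a v.
Proof.
rewrite /qf_eval mulr_sumr; apply: eq_bigr => i _; rewrite mulr_sumr.
by apply: eq_bigr => j _; ring.
Qed.

Lemma qf_eval_intr (v : 'I_r -> int) :
  qf_eval a (fun i => (v i)%:~R : rat) = (qf_eval a v)%:~R.
Proof.
rewrite /qf_eval rmorph_sum; apply: eq_bigr => i _; rewrite rmorph_sum.
by apply: eq_bigr => j _; rewrite !rmorphM /= intz.
Qed.

Hypothesis a_pos : pos_def a.

Lemma qf_eval_ge0 (v : 'I_r -> rat) : 0 <= qf_eval a v.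
Proof.
have [/existsP [i vi]|] := boolP [exists i, v i != 0].
  by apply/ltW/a_pos; exists i.
rewrite negb_exists => /forallP v0; rewrite /qf_eval big1 // => i _.
by rewrite big1 // => j _; have /negPn/eqP-> := v0 j; rewrite mulr0.
Qed.

Lemma qf_eval_eq0 (v : 'I_r -> rat) : qf_eval a v = 0 -> forall i, v i = 0.
Proof.
move=> v0 i; apply/eqP/negPn/negP => vi.
by have := a_pos (ex_intro _ i vi); rewrite v0 ltxx.
Qed.

Lemma qf_eval_int_ge1 (v : 'I_r -> int) i :
  v i != 0 -> 1 <= qf_eval a (fun i => (v i)%:~R : rat).
Proof.
move=> vi; have := a_pos (v := fun i => (v i)%:~R).
rewrite qf_eval_intr ltr0z -[1]/(1%:~R) ler_int; apply.
by exists i; rewrite intr_eq0.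
Qed.

End QuadraticForm.

(** Only [a i j] with [i <= j] enters the form, so its polar form is written as Q(A + B) - Q(A) -
    Q(B); this keeps every coefficient a combination of values of Q. *)
Lemma qf_eval_affine (R : comNzRingType) (F : {rmorphism rat -> R}) (r : nat)
    (a : 'I_r -> 'I_r -> int) (A B : 'I_r -> rat) (z : R) :
  qf_eval a (fun i => F (A i) + F (B i) * z)
  = F (qf_eval a A) + F (qf_eval a (fun i => A i + B i) - qf_eval a A - qf_eval a B) * z
    + F (qf_eval a B) * (z * z).
Proof.
rewrite /qf_eval !(rmorphB, rmorph_sum) !mulrBl !mulr_suml -!sumrB -!big_split /=.
apply: eq_bigr => i _.
rewrite !rmorph_sum !mulr_suml -!sumrB -!big_split /=.
apply: eq_bigr => j _ /=; ring.
Qed.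

Lemma qf_eval_mull (R : comNzRingType) (F : {rmorphism rat -> R}) (r : nat)
    (a : 'I_r -> 'I_r -> int) (c : 'I_r -> rat) (x : R) :
  qf_eval a (fun i => F (c i) * x) = F (qf_eval a c) * (x * x).
Proof.
rewrite /qf_eval !rmorph_sum !mulr_suml; apply: eq_bigr => i _.
by rewrite !rmorph_sum !mulr_suml; apply: eq_bigr => j _ /=; ring.
Qed.

Lemma qf_eval_addZ (r : nat) (a : 'I_r -> 'I_r -> int) (B C : 'I_r -> rat) (s : rat) :
  qf_eval a (fun i => B i + s * C i) = qf_eval a B
    + s * (qf_eval a (fun i => B i + C i) - qf_eval a B - qf_eval a C) + s ^+ 2 * qf_eval a C.
Proof.
rewrite /qf_eval !mulrBr !mulr_sumr -!sumrB -!big_split; apply: eq_bigr => i _ /=.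
rewrite !mulr_sumr -!sumrB -!big_split; apply: eq_bigr => j _ /=; ring.
Qed.

(** * Algebraic integers and criteria for total positivity *)

Section Integers.
Variable L : fieldExtType rat.
Implicit Types x y : L.

Lemma in_OK_integral x : in_OK x <-> integralOver (intmul 1 : int -> L) x.
Proof. by split=> [[p [pm px]]|[p pm px]]; exists p. Qed.

Lemma in_OKD {x y} : in_OK x -> in_OK y -> in_OK (x + y).
Proof. by rewrite !in_OK_integral; apply: integral_add. Qed.

Lemma in_OKM {x y} : in_OK x -> in_OK y -> in_OK (x * y).
Proof. by rewrite !in_OK_integral; apply: integral_mul. Qed.

Lemma in_OKN {x} : in_OK x -> in_OK (- x).
Proof. by rewrite !in_OK_integral; apply: integral_opp. Qed.

Lemma in_OKB {x y} : in_OK x -> in_OK y -> in_OK (x - y).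
Proof. by move=> ? ?; apply/in_OKD/in_OKN. Qed.

Lemma in_OKz (k : int) : in_OK (k%:~R : L).
Proof. by rewrite in_OK_integral; apply: integral_id. Qed.

Lemma in_OK_rmorph (f : {rmorphism L -> L}) x : in_OK x -> in_OK (f x).
Proof.
move=> [p [pm px]]; exists p; split=> //.
have -> : map_poly (fun z : int => z%:~R : L) p
  = map_poly f (map_poly (fun z : int => z%:~R) p).
  by rewrite -map_poly_comp; apply: eq_map_poly => z /=; rewrite rmorph_int.
by rewrite fmorph_root.
Qed.

Lemma in_OK_Aint (f : {rmorphism L -> algC}) x : in_OK x -> f x \in Aint.
Proof.
move=> [p [pm px]]; apply: (@root_monic_Aint (map_poly intr p)).
- have -> : map_poly intr p = map_poly f (map_poly (fun z : int => z%:~R) p).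
    by rewrite -map_poly_comp; apply: eq_map_poly => z /=; rewrite rmorph_int.
  by rewrite fmorph_root.
- exact: monic_map.
- by apply/polyOverP => i; rewrite coef_map /=; apply: intr_int.
Qed.

Lemma in_OK_rat (q : rat) : in_OK (q%:A : L) -> exists k : int, q = k%:~R.
Proof.
move=> [p [pm px]].
have : (ratr q : algC) \in Num.int.
  apply: Cint_rat_Aint; first exact: Crat_rat.
  apply: (@root_monic_Aint (map_poly intr p)).
  - have pq : root (map_poly intr p : {poly rat}) q.
      rewrite -(fmorph_root (in_alg L)) -map_poly_comp.
      by under eq_map_poly do rewrite /= scaler_int.
    rewrite -(fmorph_root (ratr : {rmorphism rat -> algC})) in pq.
    move: pq; rewrite -map_poly_comp.
    by under eq_map_poly do rewrite /= rmorph_int.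
  - exact: monic_map.
  - by apply/polyOverP => i; rewrite coef_map /=; apply: intr_int.
case/intrP=> k; rewrite -(rmorph_int ratr) => /fmorph_inj qk.
by exists k.
Qed.

End Integers.

Lemma monic_MXaddC (R : nzRingType) (p : {poly R}) (c : R) :
  p \is monic -> p * 'X + c%:P \is monic.
Proof.
move=> pm; rewrite monicE lead_coefDl ?lead_coefMX -?monicE //.
rewrite size_mulX ?monic_neq0 // size_polyC.
by apply: leq_ltn_trans (leq_b1 _) _; rewrite ltnS size_poly_gt0 monic_neq0.
Qed.

Lemma in_OK_quadratic (L : fieldExtType rat) (x : L) (t n : int) :
  x * x = t%:~R * x - n%:~R -> in_OK x.
Proof.
move=> xx; exists (('X - t%:P) * 'X + n%:P); split.
  exact/monic_MXaddC/monicXsubC.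
apply/rootP; rewrite rmorphD rmorphM rmorphB /= map_polyX !map_polyC /=.
by rewrite !hornerE mulrBl xx; ring.
Qed.

(** For a conjugate [x <= 0] every term of x^2 - t x + n would be nonnegative and the last one
    positive. *)
Lemma totally_positive_quadratic (L : fieldExtType rat) (x : L) (t n : int) :
  0 < t -> 0 < n -> x * x = t%:~R * x - n%:~R -> totally_positive x.
Proof.
move=> t_gt0 n_gt0 xx s s_real; have sx := s_real x.
rewrite real_ltNge ?real0 //; apply/negP => sx_le0.
have E : s x * s x - t%:~R * s x + n%:~R = 0.
  by rewrite -rmorphM xx rmorphB rmorphM !rmorph_int /=; ring.
have : 0 < s x * s x - t%:~R * s x + n%:~R.
  rewrite ltr_wpDl ?ltr0z // -mulrBl mulr_le0 // subr_le0.
  by apply: le_trans sx_le0 _; rewrite ler0z ltW.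
by rewrite E ltxx.
Qed.

Lemma in_OK_cubic (L : fieldExtType rat) (x : L) (t e f : int) :
  x ^+ 3 = t%:~R * x ^+ 2 - e%:~R * x + f%:~R -> in_OK x.
Proof.
move=> xE; exists ((('X - t%:P) * 'X + e%:P) * 'X + (- f)%:P); split.
  exact/monic_MXaddC/monic_MXaddC/monicXsubC.
apply/rootP; rewrite !(rmorphD, rmorphN, rmorphM) /= map_polyX !map_polyC /=.
rewrite !(hornerD, hornerM, hornerN, hornerX, hornerC).
transitivity (x ^+ 3 - (t%:~R * x ^+ 2 - e%:~R * x + f%:~R)); first ring.
by rewrite xE subrr.
Qed.

(** The same sign argument for x^3 - t x^2 + e x - f, which is negative for [x <= 0]. The conjugate
    is moved to the ordered field [algR], where [nra] applies. *)
Lemma totally_positive_cubic (L : fieldExtType rat) (x : L) (t e f : rat) :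
  0 < t -> 0 < e -> 0 < f ->
  x ^+ 3 = GRing.in_alg L t * x ^+ 2 - GRing.in_alg L e * x + GRing.in_alg L f ->
  totally_positive x.
Proof.
move=> t_gt0 e_gt0 f_gt0 xE s s_real; pose z : algR := in_algR (s_real x).
have salg c : s (GRing.in_alg L c) = ratr c.
  exact: (fmorph_eq_rat (s \o GRing.in_alg L)).
have zE : z ^+ 3 = ratr t * z ^+ 2 - ratr e * z + ratr f.
  apply: (fmorph_inj algRval); rewrite rmorphXn rmorphD rmorphB.
  rewrite (rmorphM _ (ratr t)) (rmorphM _ (ratr e)) rmorphXn !fmorph_rat.
  have -> : (algRval : {rmorphism algR -> algC}) z = s x by [].
  by rewrite -!salg -!rmorphXn xE !(rmorphD, rmorphN, rmorphM).
suff : 0 < z by [].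
move: t_gt0 e_gt0 f_gt0; rewrite -!(ltr0q algR); nra.
Qed.

Lemma isqrtP (n : nat) : exists s, (s * s <= n < s.+1 * s.+1)%N.
Proof.
elim: n => [|n [s /andP [s1 s2]]]; first by exists 0.
have [?|?] := ltnP n.+1 (s.+1 * s.+1); [exists s | exists s.+1]; lia.
Qed.

(** * Biquadratic fields *)

(** The odd case also records that the square is 1 modulo 8: the contradictions below are
    congruences modulo 4 or 8 that become linear once the odd squares are replaced. *)
Lemma parityP (x : int) :
  (exists p, x = 2 * p) \/ (exists p s, x = 2 * p + 1 /\ x * x = 8 * s + 1).
Proof.
have even_succ (q : int) : exists s, q * (q + 1) = 2 * s.
  have [[h]|[h]] : (exists h, q = 2 * h) \/ (exists h, q = 2 * h + 1).
  - have [?|?] : q = 2 * (q %/ 2)%Z \/ q = 2 * (q %/ 2)%Z + 1 by lia.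
    + by left; exists (q %/ 2)%Z.
    + by right; exists (q %/ 2)%Z.
  - by move=> ->; exists (h * (2 * h + 1)); ring.
  - by move=> ->; exists ((2 * h + 1) * (h + 1)); ring.
have [xE|xE] : x = 2 * (x %/ 2)%Z \/ x = 2 * (x %/ 2)%Z + 1 by lia.
- by left; exists (x %/ 2)%Z.
- right; have [s sE] := even_succ (x %/ 2)%Z.
  exists (x %/ 2)%Z, s; split=> //; rewrite {1 2}xE.
  by transitivity (4 * ((x %/ 2)%Z * ((x %/ 2)%Z + 1)) + 1);
    [ring | rewrite sE; ring].
Qed.

(* [u w] and [u v] are both 2 or both 3 modulo 4; when both are 2, coprimality
   of [v] and [w] leaves the factor 2 to [u]. *)
Definition ramified_at_2 (u v w : int) :=
  [/\ exists x, v = 2 * x + 1, exists x, w = 2 * x + 1 &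
      (exists x, u = 4 * x + 2) \/
      ((exists x, u * w = 4 * x + 3) /\ (exists x, u * v = 4 * x + 3))].

(** * Congruences at 2 for the integers of a biquadratic field *)

Section BiquadraticIntegers.
Variables (a b c d u v w S T N N1 N2 : int).
Hypothesis uvw : ramified_at_2 u v w.
Hypothesis HS : a * a + b * b * (v * w) - c * c * (u * w) - d * d * (u * v) = 8 * S.
Hypothesis HT : a * b - u * (c * d) = 4 * T.
Hypothesis HN : S * S - v * w * (T * T) = 4 * N.
Hypothesis HN1 : a * a - b * b * (v * w) = 4 * N1.

(** [a], [b], [c], [d] are the coordinates of four times an integer, and the section hypotheses are
    the integrality conditions of [biquad_integral]. If [u] is even, [HT] makes [a b] equal to 2
    modulo 4, while [HN1] gives [a] and [b] the same parity. If [u] is odd, [a] and [b] are odd too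
    and [HS] fails modulo 8. *)
Lemma biquad_not_odd pc sc pd sd : c = 2 * pc + 1 -> c * c = 8 * sc + 1 ->
  d = 2 * pd + 1 -> d * d = 8 * sd + 1 -> False.
Proof.
move=> cE ccE dE ddE.
have [[pv vE] [pw wE] [[pu uE]|[[x uwE] [y uvE]]]] := uvw.
- have [[p aE]|[p [s [aE aa]]]] := parityP a;
  have [[q bE]|[q [z [bE bb]]]] := parityP b.
  + move: HT; rewrite aE bE cE dE uE; lia.
  + move: HN1; rewrite bb aE vE wE; lia.
  + move: HN1; rewrite aa bE vE wE; lia.
  + move: HT; rewrite aE bE cE dE uE; lia.
- have [[pu uE]|[pu [su [uE uuE]]]] := parityP u.
    by move: uwE; rewrite uE; lia.
  have [[p aE]|[p [s [aE aa]]]] := parityP a.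
    by move: HT; rewrite aE cE dE uE; lia.
  have [[q bE]|[q [z [bE bb]]]] := parityP b.
    by move: HT; rewrite bE cE dE uE; lia.
  have [i iE] : exists i, v = u + 2 * i by exists (pv - pu); lia.
  have [j jE] : exists j, w = u + 2 * j by exists (pw - pu); lia.
  have j1 : exists h, u * j = 2 * h + 1.
    by exists (x - 2 * su); move: uwE; rewrite jE mulrDr uuE; lia.
  have i1 : exists h, u * i = 2 * h + 1.
    by exists (y - 2 * su); move: uvE; rewrite iE mulrDr uuE; lia.
  case: j1 => j1 j1E; case: i1 => i1 i1E.
  have jo : exists h, j = 2 * h + 1.
    have [[h hE]|[h [? [hE _]]]] := parityP j; last by exists h.
    by move: j1E; rewrite hE; lia.
  have io : exists h, i = 2 * h + 1.
    have [[h hE]|[h [? [hE _]]]] := parityP i; last by exists h.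
    by move: i1E; rewrite hE; lia.
  case: jo => jo joE; case: io => io ioE.
  (* The product (v - u)(w - u) = 4 i j with [i], [j] odd is 4 modulo 8, whereas [HS] with four odd
     squares makes it 0 modulo 8. *)
  have : v * w - u * w - u * v + u * u = 4 * (i * j) by rewrite iE jE; ring.
  have : 1 + v * w - u * w - u * v = 8 * (S - s - z * (v * w) + sc * (u * w) + sd * (u * v)).
    transitivity (8 * S - 8 * (s + z * (v * w) - sc * (u * w) - sd * (u * v))); last ring.
    by rewrite -HS aa bb ccE ddE; ring.
  rewrite joE ioE uuE; lia.
Qed.

(** Here a = 2 p and b = 2 q, and [HN] requires S^2 = v w T^2 modulo 4. For all [p], [q] compatible
    with [HS], exactly one of [S], [T] is odd, except when u w = 2 and v w = 3 modulo 4 with [p],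
    [q] odd; then both are odd and S^2 - v w T^2 is 2 modulo 4. *)
Lemma biquad_even_even pc sc pd :
  c = 2 * (2 * pc + 1) -> (2 * pc + 1) * (2 * pc + 1) = 8 * sc + 1 ->
  d = 4 * pd -> False.
Proof.
move=> cE ccE dE.
have [[pv vE] [pw wE] uP] := uvw.
have [m mE] : exists m, v * w = 2 * m + 1.
  by exists (2 * pv * pw + pv + pw); rewrite vE wE; ring.
have n23 : exists x, u * w = 4 * x + 2 \/ (u * w = 4 * x + 3 /\ exists h, v * w = 4 * h + 1).
  case: uP => [[x uE]|[[x uwE] [y uvE]]].
    by exists (x * w + pw); left; rewrite uE wE; ring.
  exists x; right; split=> //.
  have [[pu uE]|[pu [su [uE uuE]]]] := parityP u.
    by move: uwE; rewrite uE; lia.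
  have : (u * u) * (v * w) = (4 * x + 3) * (4 * y + 3).
    by rewrite -uwE -uvE; ring.
  rewrite uuE => H; exists (4 * x * y + 3 * x + 3 * y + 2 - 2 * su * (v * w)); lia.
have [[p aE]|[p [s [aE aa]]]] := parityP a; last first.
  have [[q bE]|[q [z [bE bb]]]] := parityP b.
    by move: HN1; rewrite aa bE; lia.
  by move: HT; rewrite aE bE cE dE; lia.
have [[q bE]|[q [z [bE bb]]]] := parityP b; last first.
  by move: HN1; rewrite bb aE mE; lia.
have SE : p * p + q * q * (v * w) - (8 * sc + 1) * (u * w) - 4 * (pd * pd * (u * v)) = 2 * S.
  by move: HS; rewrite aE bE cE dE -ccE; lia.
have TE : p * q - 2 * (u * ((2 * pc + 1) * pd)) = T.
  by move: HT; rewrite aE bE cE dE; lia.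
have [h hE] : exists h, v * w = 4 * h + 1 \/ v * w = 4 * h + 3.
  have [[h hE]|[h [? [hE _]]]] := parityP m; exists h; [left|right]; lia.
case: n23 => x n23; clear HS HT HN1 uvw uP; move: HN SE TE.
have [[pS SE']|[pS [sS [SE' SS]]]] := parityP S;
have [[pT TE']|[pT [sT [TE' TT]]]] := parityP T;
have [[pp pE]|[pp [sp [pE ppE]]]] := parityP p;
have [[pq qE]|[pq [sq [qE qqE]]]] := parityP q;
rewrite ?SS ?TT ?ppE ?qqE ?SE' ?TE' ?pE ?qE.
all: case: n23 => [nE|[nE [h' h'E]]]; case: hE => hE; rewrite ?nE ?hE; try lia.
Qed.
End BiquadraticIntegers.

(** If exactly one of [c], [d] were odd, the left side would be [n] or [- k] modulo 4, which is not
    0. *)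
Lemma same_parity (c d n k N : int) :
  c * c * n - d * d * k = 4 * N ->
  (exists x, n = 4 * x + 1) /\ (exists x, k = 4 * x + 1) \/
  (exists x, n = 4 * x + 2) /\ (exists x, k = 4 * x + 2) \/
  (exists x, n = 4 * x + 3) /\ (exists x, k = 4 * x + 3) ->
  exists e, c - d = 2 * e.
Proof.
move=> HN nk; have [[p cE]|[p [s [cE cc]]]] := parityP c;
have [[q dE]|[q [z [dE dd]]]] := parityP d; try by exists (p - q); lia.
- move: HN; rewrite cE dd; case: nk => [[[x ->] [y ->]]|[[[x ->] [y ->]]|[[x ->] [y ->]]]]; lia.
- move: HN; rewrite dE cc; case: nk => [[[x ->] [y ->]]|[[[x ->] [y ->]]|[[x ->] [y ->]]]]; lia.
Qed.

Lemma biquad_parity (a b c d u v w S T N N1 N2 : int) :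
  ramified_at_2 u v w ->
  a * a + b * b * (v * w) - c * c * (u * w) - d * d * (u * v) = 8 * S ->
  a * b - u * (c * d) = 4 * T ->
  S * S - v * w * (T * T) = 4 * N ->
  a * a - b * b * (v * w) = 4 * N1 ->
  c * c * (u * w) - d * d * (u * v) = 4 * N2 ->
  exists c' d' e, [/\ c = 2 * c', d = 2 * d' & c' - d' = 2 * e].
Proof.
move=> uvw HS HT HN HN1 HN2.
have [[pv vE] [pw wE] uP] := uvw.
have [e eE] : exists e, c - d = 2 * e.
  apply: same_parity HN2 _; right; case: uP => [[x uE]|[H1 H2]]; last by right.
  left; split; first by exists (x * w + pw); rewrite uE wE; ring.
  by exists (x * v + pv); rewrite uE vE; ring.
have [[p cE]|[p [s [cE cc]]]] := parityP c;
have [[q dE]|[q [z [dE dd]]]] := parityP d.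
- exists p, q; have [[p' pE]|[p' [s [pE pp]]]] := parityP p;
  have [[q' qE]|[q' [z [qE qq]]]] := parityP q; try by exists (p' - q'); split; lia.
  + have wvu : ramified_at_2 u w v.
      split; [by exists pw | by exists pv |].
      by case: uP => [?|[? ?]]; [left | right].
    case: (@biquad_even_even a b d c u w v S T N N1 wvu _ _ _ _ q' z p').
    * by rewrite -HS; ring.
    * by rewrite -HT; ring.
    * by rewrite -HN; ring.
    * by rewrite -HN1; ring.
    * by rewrite dE qE.
    * by rewrite -qE.
    * by rewrite cE pE; ring.
  + case: (@biquad_even_even a b c d u v w S T N N1 uvw HS HT HN HN1 p' s q').
    * by rewrite cE pE.
    * by rewrite -pE.
    * by rewrite dE qE; ring.
- by exists 0, 0, 0; lia.
- by exists 0, 0, 0; lia.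
- exfalso; eapply biquad_not_odd with (1 := uvw); eassumption.
Qed.

(** The square of the denominator is coprime to that of the numerator, hence divides [m]. *)
Lemma squarefree_rat (m : int) (t : rat) : squarefree `|m|%N ->
  (exists k : int, t * t * m%:~R = k%:~R) -> exists k : int, t = k%:~R.
Proof.
move=> sqm [k tk]; exists (numq t).
suff den1 : denq t = 1 by rewrite -[LHS]divq_num_den den1 divr1.
have E : numq t * numq t * m = k * (denq t * denq t).
  apply/eqP; rewrite -(eqr_int rat) !rmorphM /= -tk; apply/eqP.
  have tE : (numq t)%:~R = t * (denq t)%:~R.
    by rewrite -[X in _ = X * _]divq_num_den divfK // intr_eq0 denq_neq0.
  by rewrite tE; ring.
have cop : coprime (`|denq t| ^ 2) (`|numq t| ^ 2).
  by rewrite coprime_pexpl // coprime_pexpr // coprime_sym coprime_num_den.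
have /sqm den1 : (`|denq t| ^ 2 %| `|m|)%N.
  rewrite -(Gauss_dvdr _ cop) -!mulnn.
  by have /(congr1 absz) := E; rewrite !abszM => ->; apply: dvdn_mull.
by rewrite -(absz_denq t) den1.
Qed.

(** * Coordinates, automorphisms and integers of a biquadratic field *)

Section BiquadraticField.
Variables (L : fieldExtType rat) (u v w : int) (X Y Z : L).
Let q (c : rat) : L := GRing.in_alg L c.
Definition biquad_comb (t : (rat * rat) * (rat * rat)) : L :=
  q t.1.1 + q t.1.2 * X + q t.2.1 * Y + q t.2.2 * Z.

(** [X], [Y], [Z] are square roots of v w, u w and u v. Writing the radicands as products of pairs
    makes the description symmetric in the three quadratic subfields. *)
Record biquad_basis : Prop := BiquadBasis {
  biquadXX : X * X = (v * w)%:~R;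
  biquadYY : Y * Y = (u * w)%:~R;
  biquadZZ : Z * Z = (u * v)%:~R;
  biquadXY : X * Y = w%:~R * Z;
  biquadXZ : X * Z = v%:~R * Y;
  biquadYZ : Y * Z = u%:~R * X;
  biquad_span : forall e, exists t, e = biquad_comb t;
  biquad_free : forall t, biquad_comb t = 0 -> t = ((0, 0), (0, 0))
}.

Hypothesis B : biquad_basis.

Definition biquad_coord e := sval (sig_eqW (biquad_span B e)).

Lemma biquad_coordK e : biquad_comb (biquad_coord e) = e.
Proof. by rewrite /biquad_coord; case: sig_eqW. Qed.

Lemma biquad_comb_inj : injective biquad_comb.
Proof.
move=> [[a b] [c d]] [[a' b'] [c' d']] E.
have /(biquad_free B) [] : biquad_comb ((a - a', b - b'), (c - c', d - d')) = 0.
  move/eqP: E; rewrite -subr_eq0 => /eqP <-; rewrite /biquad_comb /q /fst /snd.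
  ring.
by do 4![move/subr0_eq->].
Qed.

Lemma biquad_combK t : biquad_coord (biquad_comb t) = t.
Proof. by apply: biquad_comb_inj; rewrite biquad_coordK. Qed.

Definition biquad_mul (s t : (rat * rat) * (rat * rat)) : (rat * rat) * (rat * rat) :=
  let: ((a, b), (c, d)) := s in let: ((a', b'), (c', d')) := t in
  ((a * a' + (v * w)%:~R * (b * b') + (u * w)%:~R * (c * c') + (u * v)%:~R * (d * d'),
    a * b' + b * a' + u%:~R * (c * d' + d * c')),
   (a * c' + c * a' + v%:~R * (b * d' + d * b'),
    a * d' + d * a' + w%:~R * (b * c' + c * b'))).

Lemma biquad_combM s t : biquad_comb s * biquad_comb t = biquad_comb (biquad_mul s t).
Proof.
case: s t => [[a b] [c d]] [[a' b'] [c' d']]; rewrite /biquad_comb /q /biquad_mul /fst /snd.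
transitivity (GRing.in_alg L (a * a') + GRing.in_alg L (b * b') * (X * X)
   + GRing.in_alg L (c * c') * (Y * Y) + GRing.in_alg L (d * d') * (Z * Z)
   + GRing.in_alg L (a * b' + b * a') * X + GRing.in_alg L (c * d' + d * c') * (Y * Z)
   + GRing.in_alg L (a * c' + c * a') * Y + GRing.in_alg L (b * d' + d * b') * (X * Z)
   + GRing.in_alg L (a * d' + d * a') * Z + GRing.in_alg L (b * c' + c * b') * (X * Y)).
  ring.
case: B => -> -> -> -> -> -> _ _; ring.
Qed.

Section Automorphism.
Variables s1 s2 : rat.
Hypotheses (s1s1 : s1 * s1 = 1) (s2s2 : s2 * s2 = 1).

(** The sign of [Z] is the product of those of [X] and [Y] because X Y = w Z. *)
Definition biquad_sgn (t : (rat * rat) * (rat * rat)) : (rat * rat) * (rat * rat) :=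
  ((t.1.1, s1 * t.1.2), (s2 * t.2.1, s1 * s2 * t.2.2)).

Lemma biquad_sgnM s t :
  biquad_mul (biquad_sgn s) (biquad_sgn t) = biquad_sgn (biquad_mul s t).
Proof.
case: s t => [[a b] [c d]] [[a' b'] [c' d']]; rewrite /biquad_sgn /biquad_mul /=.
congr ((_, _), (_, _)).
- transitivity (a * a' + (v * w)%:~R * (b * b') * (s1 * s1)
    + (u * w)%:~R * (c * c') * (s2 * s2)
    + (u * v)%:~R * (d * d') * (s1 * s1) * (s2 * s2)); first ring.
  by rewrite s1s1 s2s2; ring.
- transitivity (s1 * (a * b' + b * a' + u%:~R * (c * d' + d * c') * (s2 * s2))); first ring.
  by rewrite s2s2; ring.
- transitivity (s2 * (a * c' + c * a' + v%:~R * (b * d' + d * b') * (s1 * s1))); first ring.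
  by rewrite s1s1; ring.
- ring.
Qed.

Lemma biquad_aut : exists f : {rmorphism L -> L},
  forall t, f (biquad_comb t) = biquad_comb (biquad_sgn t).
Proof.
pose f e := biquad_comb (biquad_sgn (biquad_coord e)).
have fE t : f (biquad_comb t) = biquad_comb (biquad_sgn t) by rewrite /f biquad_combK.
have fB : zmod_morphism f.
  move=> x y; rewrite -(biquad_coordK x) -(biquad_coordK y) !fE.
  case: (biquad_coord x) (biquad_coord y) => [[a b] [c d]] [[a' b'] [c' d']].
  have -> : biquad_comb ((a, b), (c, d)) - biquad_comb ((a', b'), (c', d'))
     = biquad_comb ((a - a', b - b'), (c - c', d - d')).
    by rewrite /biquad_comb /q /fst /snd; ring.
  by rewrite fE /biquad_comb /q /biquad_sgn /fst /snd; ring.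
have fM : monoid_morphism f.
  split=> [|x y].
    have -> : (1 : L) = biquad_comb ((1, 0), (0, 0)).
      by rewrite /biquad_comb /q /fst /snd; ring.
    by rewrite fE /biquad_sgn /= !mulr0.
  rewrite -(biquad_coordK x) -(biquad_coordK y) biquad_combM !fE biquad_combM.
  by rewrite biquad_sgnM.
pose fZ := GRing.isZmodMorphism.Build L L f fB.
pose fR := GRing.isMonoidMorphism.Build L L f fM.
pose F : {rmorphism L -> L} := HB.pack f fZ fR.
by exists F.
Qed.

End Automorphism.

Hypotheses (sq_vw : squarefree `|(v * w)%R|%N) (sq_uw : squarefree `|(u * w)%R|%N)
  (sq_uv : squarefree `|(u * v)%R|%N).

Lemma in_OK_biquad_rat t k : in_OK (biquad_comb t) -> t = ((k, 0), (0, 0)) ->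
  exists z : int, k = z%:~R.
Proof.
move=> tI tE; apply: (@in_OK_rat L); move: tI; rewrite tE.
by rewrite /biquad_comb /q /fst /snd !rmorph0 !mul0r !addr0.
Qed.

Lemma biquad_combD s t : biquad_comb s + biquad_comb t =
  biquad_comb ((s.1.1 + t.1.1, s.1.2 + t.1.2), (s.2.1 + t.2.1, s.2.2 + t.2.2)).
Proof.
case: s t => [[a b] [c d]] [[a' b'] [c' d']].
by rewrite /biquad_comb /q /fst /snd; ring.
Qed.

Lemma biquad_combB s t : biquad_comb s - biquad_comb t =
  biquad_comb ((s.1.1 - t.1.1, s.1.2 - t.1.2), (s.2.1 - t.2.1, s.2.2 - t.2.2)).
Proof.
case: s t => [[a b] [c d]] [[a' b'] [c' d']].
by rewrite /biquad_comb /q /fst /snd; ring.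
Qed.

(** The denominator 4 comes from combining the four conjugates of an integer e. With f1 the
    conjugation fixing [X], the product e f1(e) = G + H X yields [S] from its trace, [N] from its
    norm and [T] from its [X]-coordinate; [N1] and [N2] come from relative norms of e + f1(e) and e
    - f1(e). *)
Lemma biquad_integral t : in_OK (biquad_comb t) ->
  exists a b c d S T N N1 N2 : int,
  [/\ t = ((a%:~R / 4, b%:~R / 4), (c%:~R / 4, d%:~R / 4)),
      a * a + b * b * (v * w) - c * c * (u * w) - d * d * (u * v) = 8 * S,
      a * b - u * (c * d) = 4 * T /\ S * S - v * w * (T * T) = 4 * N,
      a * a - b * b * (v * w) = 4 * N1 &
      c * c * (u * w) - d * d * (u * v) = 4 * N2].
Proof.
case: t => [[a b] [c d]] tI.
have N1E : (-1) * (-1) = 1 :> rat by [].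
have [f1 f1E] := biquad_aut (mulr1 1) N1E.
have [f2 f2E] := biquad_aut N1E (mulr1 1).
have ratP t k : in_OK (biquad_comb t) -> t = ((k, 0), (0, 0)) ->
    exists z : int, k = z%:~R by apply: in_OK_biquad_rat.
have eqI s t : in_OK (biquad_comb s) -> s = t -> in_OK (biquad_comb t).
  by move=> sI <-.
have mulI s t : in_OK (biquad_comb s) -> in_OK (biquad_comb t) ->
    in_OK (biquad_comb (biquad_mul s t)).
  by move=> sI tI'; rewrite -biquad_combM; apply: in_OKM.
have f1I t : in_OK (biquad_comb t) -> in_OK (biquad_comb (biquad_sgn 1 (-1) t)).
  by move=> /(in_OK_rmorph f1); rewrite f1E.
have f2I t : in_OK (biquad_comb t) -> in_OK (biquad_comb (biquad_sgn (-1) 1 t)).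
  by move=> /(in_OK_rmorph f2); rewrite f2E.
have xI : in_OK (biquad_comb ((2 * a, 2 * b), (0, 0))).
  have := in_OKD tI (f1I _ tI); rewrite biquad_combD => /eqI; apply.
  by congr ((_, _), (_, _)) => /=; ring.
have yI : in_OK (biquad_comb ((0, 0), (2 * c, 2 * d))).
  have := in_OKB tI (f1I _ tI); rewrite biquad_combB => /eqI; apply.
  by congr ((_, _), (_, _)) => /=; ring.
pose G := a * a + (v * w)%:~R * (b * b) - (u * w)%:~R * (c * c) - (u * v)%:~R * (d * d).
pose H := 2 * (a * b - u%:~R * (c * d)).
have zI : in_OK (biquad_comb ((G, H), (0, 0))).
  apply: eqI (mulI _ _ tI (f1I _ tI)) _; rewrite /G /H.
  by congr ((_, _), (_, _)) => /=; ring.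
have [a' aE] : exists z : int, 4 * a = z%:~R.
  have := in_OKD xI (f2I _ xI); rewrite biquad_combD => /ratP; apply.
  by congr ((_, _), (_, _)) => /=; ring.
(* The integer 4 b X has the rational square (4 b)^2 v w, and squarefreeness of v w removes the
   denominator of 4 b. The next two coordinates are treated in the same way. *)
have [b' bE] : exists z : int, 4 * b = z%:~R.
  have wI := in_OKB xI (f2I _ xI); rewrite biquad_combB in wI.
  apply: (squarefree_rat sq_vw); apply: ratP (mulI _ _ wI wI) _.
  by congr ((_, _), (_, _)) => /=; ring.
have [c' cE] : exists z : int, 4 * c = z%:~R.
  have wI := in_OKD yI (f2I _ yI); rewrite biquad_combD in wI.
  apply: (squarefree_rat sq_uw); apply: ratP (mulI _ _ wI wI) _.
  by congr ((_, _), (_, _)) => /=; ring.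
have [d' dE] : exists z : int, 4 * d = z%:~R.
  have wI := in_OKB yI (f2I _ yI); rewrite biquad_combB in wI.
  apply: (squarefree_rat sq_uv); apply: ratP (mulI _ _ wI wI) _.
  by congr ((_, _), (_, _)) => /=; ring.
have [N1 N1P] : exists z : int, 4 * a * a - 4 * b * b * (v * w)%:~R = z%:~R.
  by apply: ratP (mulI _ _ xI (f2I _ xI)) _; congr ((_, _), (_, _)) => /=; ring.
have [N2 N2P] : exists z : int, 4 * c * c * (u * w)%:~R - 4 * d * d * (u * v)%:~R = z%:~R.
  by apply: ratP (mulI _ _ yI (f2I _ yI)) _; congr ((_, _), (_, _)) => /=; ring.
have [S SP] : exists z : int, 2 * G = z%:~R.
  have := in_OKD zI (f2I _ zI); rewrite biquad_combD => /ratP; apply.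
  by congr ((_, _), (_, _)) => /=; ring.
have [N NP] : exists z : int, G * G - (v * w)%:~R * (H * H) = z%:~R.
  by apply: ratP (mulI _ _ zI (f2I _ zI)) _; congr ((_, _), (_, _)) => /=; ring.
(* The trace and the norm of G + H X show that (2 H)^2 v w = S^2 - 4 N is an integer. *)
have [T TP] : exists z : int, 2 * H = z%:~R.
  apply: (squarefree_rat sq_vw); exists (S * S - 4 * N).
  by rewrite rmorphB !rmorphM /= -SP -NP; ring.
have aE' : a = a'%:~R / 4 by rewrite -aE; field.
have bE' : b = b'%:~R / 4 by rewrite -bE; field.
have cE' : c = c'%:~R / 4 by rewrite -cE; field.
have dE' : d = d'%:~R / 4 by rewrite -dE; field.
exists a', b', c', d', S, T, N, N1, N2; split.
- by rewrite aE' bE' cE' dE'.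
- apply: (@intr_inj rat); rewrite !(rmorphB, rmorphD, rmorphM) /= -SP /G.
  by rewrite aE' bE' cE' dE'; field.
- split; apply: (@intr_inj rat).
    by rewrite !(rmorphB, rmorphD, rmorphM) /= -TP /H aE' bE' cE' dE'; field.
  by rewrite !(rmorphB, rmorphD, rmorphM) /= -TP -SP -NP; ring.
- apply: (@intr_inj rat); rewrite !(rmorphB, rmorphD, rmorphM) /= -N1P aE' bE'.
  by field.
- apply: (@intr_inj rat); rewrite !(rmorphB, rmorphD, rmorphM) /= -N2P cE' dE'.
  by field.
Qed.

End BiquadraticField.

(** * The trace bound over a quadratic subfield *)

Section BiquadraticForm.
Variables (L : fieldExtType rat) (u v w : int) (X Y Z : L).
Hypothesis B : @biquad_basis L u v w X Y Z.
Variables (r : nat) (a : 'I_r -> 'I_r -> int).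
Hypothesis a_pos : pos_def a.

Let comb := biquad_comb X Y Z.
Let coord := biquad_coord B.

Lemma biquad_coordB x y : coord (x - y) =
  (((coord x).1.1 - (coord y).1.1, (coord x).1.2 - (coord y).1.2),
   ((coord x).2.1 - (coord y).2.1, (coord x).2.2 - (coord y).2.2)).
Proof.
apply: (biquad_comb_inj B).
by rewrite -biquad_combB !(biquad_coordK B).
Qed.

Lemma biquad_coordM x y : coord (x * y) = biquad_mul u v w (coord x) (coord y).
Proof.
apply: (biquad_comb_inj B).
by rewrite -(biquad_combM B) !(biquad_coordK B).
Qed.

(** The first coordinate is a quarter of the trace, and 1, [X], [Y], [Z] are orthogonal for the
    trace form, so no mixed terms survive. *)
Lemma biquad_qf_coord1 (V : 'I_r -> L) :
  (coord (qf_eval a V)).1.1 =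
    qf_eval a (fun i => (coord (V i)).1.1)
    + (v * w)%:~R * qf_eval a (fun i => (coord (V i)).1.2)
    + (u * w)%:~R * qf_eval a (fun i => (coord (V i)).2.1)
    + (u * v)%:~R * qf_eval a (fun i => (coord (V i)).2.2).
Proof.
pose f e : rat := (coord e).1.1.
have fB : zmod_morphism f by move=> x y; rewrite /f biquad_coordB.
pose F : {additive L -> rat} := HB.pack f (GRing.isZmodMorphism.Build L rat f fB).
rewrite -[LHS]/(F _) raddf_qf_eval /qf_eval !mulr_sumr -!big_split /=.
apply: eq_bigr => i _; rewrite !mulr_sumr -!big_split /=.
apply: eq_bigr => j _; rewrite /f biquad_coordM.
case: (coord (V i)) (coord (V j)) => [[? ?] [? ?]] [[? ?] [? ?]] /=; ring.
Qed.

(** Products of two elements of Q + Q X, and products of two elements of Q Y + Q Z, lie in Q + Q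
    X. *)
Lemma biquad_qf_coordY (V : 'I_r -> L) :
  (forall i, (coord (V i)).1 = (0, 0)) \/ (forall i, (coord (V i)).2 = (0, 0)) ->
  (coord (qf_eval a V)).2.1 = 0.
Proof.
move=> V0; pose f e : rat := (coord e).2.1.
have fB : zmod_morphism f by move=> x y; rewrite /f biquad_coordB.
pose F : {additive L -> rat} := HB.pack f (GRing.isZmodMorphism.Build L rat f fB).
rewrite -[LHS]/(F _) raddf_qf_eval big1 // => i _; rewrite big1 // => j _.
rewrite /= /f biquad_coordM; case: V0 => V0; move: (V0 i) (V0 j);
case: (coord (V i)) (coord (V j)) => [[? ?] [? ?]] [[? ?] [? ?]] /=;
by move=> [-> ->] [-> ->] /=; ring.
Qed.

(* The hypothesis says that the projection of the ring of integers to the plane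
   spanned by [Y, Z] lies in the lattice of all [(c Y + d Z) / N] with [c, d]
   of the same parity, on which [n c^2 + k d^2] is at least [min (4 n, n + k)],
   even after tensoring with an integral form. *)
Lemma biquad_not_represented (N x y : rat) (V : 'I_r -> L) :
  0 < N ->
  (forall e, in_OK e -> exists c d h : int,
     [/\ (coord e).2.1 = c%:~R / N, (coord e).2.2 = d%:~R / N & c - d = 2 * h]) ->
  0 < v * w -> 0 < u * w -> 0 < u * v -> u * w <= u * v ->
  N ^+ 2 * x <= 4 * (u * w)%:~R -> N ^+ 2 * x <= (u * w + u * v)%:~R ->
  (forall i, in_OK (V i)) -> y != 0 ->
  qf_eval a V = comb ((x, 0), (y, 0)) -> False.
Proof.
move=> N_gt0 lattice m_gt0 n_gt0 k_gt0 le_nk le_x4n le_xnk VI y_neq0 E.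
have E1 := biquad_qf_coord1 V; have EY := @biquad_qf_coordY V.
rewrite E /coord /comb (biquad_combK B) /= -/coord in E1 EY.
pose A i := (coord (V i)).1.1; pose A' i := (coord (V i)).1.2.
pose C i := (coord (V i)).2.1; pose D i := (coord (V i)).2.2.
have E1' : x = qf_eval a A + (v * w)%:~R * qf_eval a A'
    + (u * w)%:~R * qf_eval a C + (u * v)%:~R * qf_eval a D by [].
have /fin_all_exists [c /fin_all_exists [d /fin_all_exists [h cdh]]] i :=
  lattice _ (VI i).
have CE : qf_eval a C = qf_eval a (fun i => (c i)%:~R) / N ^+ 2.
  rewrite mulrC -exprVn -qf_eval_scale; apply: qf_eval_eq => i.
  by rewrite /C; case: (cdh i) => -> _ _; rewrite mulrC.
have DE : qf_eval a D = qf_eval a (fun i => (d i)%:~R) / N ^+ 2.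
  rewrite mulrC -exprVn -qf_eval_scale; apply: qf_eval_eq => i.
  by rewrite /D; case: (cdh i) => _ -> _; rewrite mulrC.
have double_ge4 (e : 'I_r -> int) i : e i != 0 -> (forall i, exists g, e i = 2 * g) ->
    4 <= qf_eval a (fun i => (e i)%:~R : rat).
  move=> ei /fin_all_exists [g eE].
  have -> : qf_eval a (fun i => (e i)%:~R : rat) = 4 * qf_eval a (fun i => (g i)%:~R : rat).
    rewrite (_ : 4 = 2 ^+ 2 :> rat) // -qf_eval_scale; apply: qf_eval_eq => j.
    by rewrite eE rmorphM.
  have : 1 <= qf_eval a (fun i => (g i)%:~R : rat).
    by apply: (@qf_eval_int_ge1 _ _ a_pos g i); move: ei; rewrite eE mulf_eq0.
  by lra.
(* If only one of [c], [d] is nonzero, all its entries are even and [Q] is at least 4 there; u w <=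
   u v makes 4 u w the smaller of the two outcomes. If both are nonzero, each contributes at least
   1. *)
have cd_bound : (exists i, c i != 0) \/ (exists i, d i != 0) ->
    N ^+ 2 * x <= (u * w)%:~R * qf_eval a (fun i => (c i)%:~R)
       + (u * v)%:~R * qf_eval a (fun i => (d i)%:~R).
  have n_gt0' : 0 < (u * w)%:~R :> rat by rewrite ltr0z.
  have le_nk' : (u * w)%:~R <= (u * v)%:~R :> rat by rewrite ler_int.
  have c0 := qf_eval_ge0 a_pos (fun i => (c i)%:~R).
  have d0 := qf_eval_ge0 a_pos (fun i => (d i)%:~R).
  move: le_xnk; rewrite rmorphD /= => le_xnk'.
  have [/existsP [i ci]|] := boolP [exists i, c i != 0];
  have [/existsP [j dj]|] := boolP [exists i, d i != 0].
  - have := qf_eval_int_ge1 a_pos ci; have := qf_eval_int_ge1 a_pos dj; nra.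
  - rewrite negb_exists => /forallP d_0 _.
    have : 4 <= qf_eval a (fun i => (c i)%:~R : rat).
      apply: double_ge4 ci _ => j; exists (h j).
      by case: (cdh j) => _ _ <-; have /negPn/eqP-> := d_0 j; rewrite subr0.
    by nra.
  - rewrite negb_exists => /forallP c_0 _.
    have : 4 <= qf_eval a (fun i => (d i)%:~R : rat).
      apply: double_ge4 dj _ => i; exists (- h i).
      by case: (cdh i) => _ _; have /negPn/eqP-> := c_0 i; lia.
    by nra.
  - by rewrite !negb_exists => /forallP d_0 /forallP c_0 [[i]|[i]] H;
      [have := c_0 i | have := d_0 i]; rewrite H.
have CD_neq0 : (exists i, c i != 0) \/ (exists i, d i != 0).
  have [/existsP [i ci]|] := boolP [exists i, c i != 0]; first by left; exists i.
  have [/existsP [j dj]|] := boolP [exists i, d i != 0]; first by right; exists j.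
  rewrite !negb_exists => /forallP d_0 /forallP c_0.
  case/eqP: y_neq0; apply: EY; right=> i; apply/eqP; rewrite -pair_eqE /=.
  case: (cdh i) => -> -> _; have /negPn/eqP-> := c_0 i.
  by have /negPn/eqP-> := d_0 i; rewrite !mul0r eqxx.
have N2_gt0 : 0 < N ^+ 2 by rewrite exprn_gt0.
have le_xCD : x <= (u * w)%:~R * qf_eval a C + (u * v)%:~R * qf_eval a D.
  rewrite CE DE !mulrA -mulrDl ler_pdivlMr // mulrC; exact: cd_bound.
have m_gt0' : 0 < (v * w)%:~R :> rat by rewrite ltr0z.
have A_ge0 := qf_eval_ge0 a_pos A; have A'_ge0 := qf_eval_ge0 a_pos A'.
(* The bound on [x] leaves nothing for the components along 1 and [X]. All [V i] therefore lie in
   the plane of [Y] and [Z], where [Q] cannot produce a multiple of [Y]. *)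
have A_eq0 : qf_eval a A = 0 by nra.
have A'_eq0 : qf_eval a A' = 0 by nra.
case/eqP: y_neq0; apply: EY; left=> i; apply/eqP; rewrite -pair_eqE /=.
by apply/andP; split; apply/eqP; [exact: (qf_eval_eq0 a_pos A_eq0) |
  exact: (qf_eval_eq0 a_pos A'_eq0)].
Qed.

End BiquadraticForm.

Record biquad_data (L : fieldExtType rat) (u v w : nat) (X Y Z : L) : Prop := BiquadData {
  biquad_data_basis :> biquad_basis (Posz u) (Posz v) (Posz w) X Y Z;
  biquad_coprime_uv : coprime u v;
  biquad_coprime_uw : coprime u w;
  biquad_coprime_vw : coprime v w;
  biquad_squarefree_vw : squarefree (v * w);
  biquad_squarefree_uw : squarefree (u * w);
  biquad_squarefree_uv : squarefree (u * v);
  biquad_gt1_vw : (1 < v * w)%N;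
  biquad_gt1_uw : (1 < u * w)%N;
  biquad_gt1_uv : (1 < u * v)%N
}.

Section Symmetry.
Variables (L : fieldExtType rat).

Lemma biquad_data_swapXY u v w (X Y Z : L) : biquad_data u v w X Y Z -> biquad_data v u w Y X Z.
Proof.
case=> -[XX YY ZZ XY XZ YZ sp fr] cuv cuw cvw svw suw suv gvw guw guv.
split; rewrite ?[(v * u)%N]mulnC // 1?coprime_sym //; split=> //.
- by rewrite ZZ mulrC.
- by rewrite mulrC.
- move=> e; have [[[a b] [c d]] ->] := sp e; exists ((a, c), (b, d)).
  by rewrite /biquad_comb /fst /snd; ring.
- move=> [[a b] [c d]] E.
  have /fr [-> -> -> ->] // : biquad_comb X Y Z ((a, c), (b, d)) = 0.
  by rewrite -E /biquad_comb /fst /snd; ring.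
Qed.

Lemma biquad_data_swapYZ u v w (X Y Z : L) : biquad_data u v w X Y Z -> biquad_data u w v X Z Y.
Proof.
case=> -[XX YY ZZ XY XZ YZ sp fr] cuv cuw cvw svw suw suv gvw guw guv.
split; rewrite ?[(w * v)%N]mulnC // 1?coprime_sym //; split=> //.
- by rewrite XX mulrC.
- by rewrite mulrC.
- move=> e; have [[[a b] [c d]] ->] := sp e; exists ((a, b), (d, c)).
  by rewrite /biquad_comb /fst /snd; ring.
- move=> [[a b] [c d]] E.
  have /fr [-> -> -> ->] // : biquad_comb X Y Z ((a, b), (d, c)) = 0.
  by rewrite -E /biquad_comb /fst /snd; ring.
Qed.

Lemma biquad_data_neq u v w (X Y Z : L) : biquad_data u v w X Y Z ->
  [/\ u != v, u != w & v != w].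
Proof.
case=> _ cuv cuw cvw _ _ _ gvw guw guv; split; apply/eqP => E; subst.
- by move: cuv guv; rewrite /coprime gcdnn => /eqP->.
- by move: cuw guw; rewrite /coprime gcdnn => /eqP->.
- by move: cvw gvw; rewrite /coprime gcdnn => /eqP->.
Qed.
End Symmetry.

(** * Totally positive integers that violate the bound *)

Section BiquadraticContradiction.
Variables (L : fieldExtType rat) (r : nat) (a : 'I_r -> 'I_r -> int).
Hypotheses (a_pos : pos_def a) (a_univ : universal_over L a).

Lemma squarefree_abszM (u v : nat) : squarefree (u * v) -> squarefree `|(Posz u * Posz v)%R|%N.
Proof. by rewrite abszM. Qed.

(** Serves to sharpen u w < u v to u w + 4 <= u v, the gap that the bound 4 (s + 1) <= u w + u v
    needs. *)
Lemma ramified_at_2_mod4 (u v w : int) : ramified_at_2 u v w ->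
  exists h, u * v - u * w = 4 * h.
Proof.
case=> [[x ->] [y ->] [[z ->]|[[z ->] [t ->]]]]; last by exists (t - z); lia.
by exists ((2 * z + 1) * (x - y)); ring.
Qed.

Lemma biquad_lattice_ramified (u v w : nat) (X Y Z : L) (D : biquad_data u v w X Y Z) e :
  ramified_at_2 u v w -> in_OK e ->
  exists c d h : int, [/\ (biquad_coord D e).2.1 = c%:~R / 2,
    (biquad_coord D e).2.2 = d%:~R / 2 & c - d = 2 * h].
Proof.
move=> ram; rewrite -{1}(biquad_coordK D e) => /(biquad_integral D
  (squarefree_abszM (biquad_squarefree_vw D))
  (squarefree_abszM (biquad_squarefree_uw D))
  (squarefree_abszM (biquad_squarefree_uv D))).
case=> a' [b' [c' [d' [S [T [N [N1 [N2 [-> HS [HT HN] HN1 HN2]]]]]]]]].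
have [c [d [h [-> -> cd]]]] := biquad_parity ram HS HT HN HN1 HN2.
by exists c, d, h; split=> //=; rewrite rmorphM /=; field.
Qed.

Lemma biquad_lattice_unramified (u v w : nat) (X Y Z : L) (D : biquad_data u v w X Y Z) e :
  (u * w = 1 %[mod 4])%N -> (u * v = 1 %[mod 4])%N -> in_OK e ->
  exists c d h : int, [/\ (biquad_coord D e).2.1 = c%:~R / 4,
    (biquad_coord D e).2.2 = d%:~R / 4 & c - d = 2 * h].
Proof.
move=> uw1 uv1; rewrite -{1}(biquad_coordK D e) => /(biquad_integral D
  (squarefree_abszM (biquad_squarefree_vw D))
  (squarefree_abszM (biquad_squarefree_uw D))
  (squarefree_abszM (biquad_squarefree_uv D))).
case=> a' [b' [c' [d' [S [T [N [N1 [N2 [-> HS [HT HN] HN1 HN2]]]]]]]]].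
have [|h cd] := same_parity HN2 _; last by exists c', d', h.
left; split; [exists (Posz (u * w %/ 4)) | exists (Posz (u * v %/ 4))].
  by rewrite -PoszM {1}(divn_eq (u * w) 4) uw1; lia.
by rewrite -PoszM {1}(divn_eq (u * v) 4) uv1; lia.
Qed.

Lemma biquad_not_universal_ramified (u v w : nat) (X Y Z : L) :
  biquad_data u v w X Y Z -> ramified_at_2 u v w -> (w < v)%N -> False.
Proof.
move=> D ram lt_wv.
have [h hE] := ramified_at_2_mod4 ram.
have [s /andP [s_le s_gt]] := isqrtP (u * w).
have uw_gt1 := biquad_gt1_uw D; have vw_gt1 := biquad_gt1_vw D.
have lt_uwuv : (u * w < u * v)%N by rewrite ltn_pmul2l //; lia.
have uv_ge : (u * w + 4 <= u * v)%N by lia.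
(* [s + 1] is the least integer above the square root of u w, so this is the translate of [Y] by an
   integer that is totally positive with least trace. *)
pose alpha := Y + (Posz s.+1)%:~R.
have alphaE : alpha * alpha = (Posz (2 * s.+1))%:~R * alpha - (Posz (s.+1 * s.+1) - Posz u * Posz w)%:~R.
  rewrite /alpha rmorphB /= -(biquadYY D); ring.
have /a_univ [|V [VI VE]] := in_OK_quadratic alphaE.
  by apply: totally_positive_quadratic alphaE => //; lia.
apply: (@biquad_not_represented _ _ _ _ _ _ _ D _ _ a_pos 2 (s.+1)%:R 1 V) => //.
- by move=> e; apply: biquad_lattice_ramified.
- by lia.
- by lia.
- by lia.
- by lia.
- have : (4 * s.+1 <= 4 * (u * w))%N by nia.
  by rewrite -(ler_nat rat) !natrM /= => H; rewrite rmorphM /=; lra.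
- have : (4 * s.+1 <= u * w + u * v)%N by nia.
  by rewrite -(ler_nat rat) natrD !natrM /= => H; rewrite rmorphD !rmorphM /=; lra.
- by rewrite VE /alpha /biquad_comb /fst /snd; ring.
Qed.

Lemma biquad_not_universal_unramified (u v w : nat) (X Y Z : L) :
  biquad_data u v w X Y Z -> (w < v)%N -> (v < u)%N ->
  (v * w = 1 %[mod 4])%N -> (u * w = 1 %[mod 4])%N -> (u * v = 1 %[mod 4])%N -> False.
Proof.
move=> D lt_wv lt_vu vw1 uw1 uv1.
have uw_gt1 := biquad_gt1_uw D; have vw_gt1 := biquad_gt1_vw D.
(* The root of u w lies between the consecutive odd numbers 2 i - 1 and 2 i + 1, so [j] below is the
   least odd integer above it; oddness is needed for (j + Y) / 2 to be integral. *)
have [i [i_gt0 i_le i_gt]] : exists i, [/\ (0 < i)%N, ((2 * i).-1 * (2 * i).-1 <= u * w)%N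
    & (u * w < (2 * i).+1 * (2 * i).+1)%N].
  have [s /andP [s_le s_gt]] := isqrtP (u * w).
  by exists (uphalf s); split; nia.
pose j := (2 * i).+1.
(* These are the two inequalities of [biquad_not_represented] for N = 4 and x = j / 2. The value u w
   = 9 would give j = 5 and violate the first one. *)
have n_big : (2 * j <= u * w)%N /\ (8 * j <= u * w + u * v)%N.
  have u9 : (u * w)%N != 9.
    apply/eqP => uw9; have := biquad_squarefree_uw D; rewrite uw9.
    by move=> /(_ 3 isT).
  have w1 : (w = 1 \/ 3 <= w)%N by nia.
  rewrite /j; case: w1 => w1.
    subst w; have : (5 <= v)%N by lia.
    have : (13 <= u)%N by lia.
    split; nia.
  have : (5 <= v)%N by nia.
  have : (7 <= u)%N by nia.
  have : (u * w)%N != 25 by nia.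
  have : (u * w + 4 <= u * v)%N by nia.
  split; nia.
pose alpha := GRing.in_alg L (1 / 2) * (Y + (Posz j)%:~R).
have [h hE] : exists h, (j * j - u * w = 4 * h)%N.
  exists (i * i + i - (u * w %/ 4))%N; rewrite /j {1}(divn_eq (u * w) 4) uw1; lia.
set half := GRing.in_alg L (1 / 2) in alpha.
have half2 : half * 2 = 1.
  by rewrite -[2](rmorph_nat (GRing.in_alg L)) -rmorphM -(rmorph1 (GRing.in_alg L));
     congr (GRing.in_alg L _); field.
have h4 : 4 * h%:R = j%:R * j%:R - Y * Y.
  rewrite (biquadYY D) -!natrM -hE natrB; last by lia.
  by rewrite -PoszM natrM.
have alphaE : alpha * alpha = (Posz j)%:~R * alpha - (Posz h)%:~R.
  transitivity (half * half * (2 * j%:R * (Y + j%:R) - 4 * h%:R)).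
    by rewrite h4 /alpha; ring.
  transitivity (j%:R * alpha * (half * 2) - h%:R * (half * 2) * (half * 2)).
    by rewrite /alpha; ring.
  by rewrite half2 !mulr1.
have /a_univ [|V [VI VE]] := in_OK_quadratic alphaE.
  by apply: totally_positive_quadratic alphaE => //; lia.
apply: (@biquad_not_represented _ _ _ _ _ _ _ D _ _ a_pos 4 (j%:R / 2) (1 / 2) V) => //.
- by move=> e; apply: biquad_lattice_unramified.
- by lia.
- by lia.
- by lia.
- by rewrite -!PoszM lez_nat leq_mul2l ltnW ?orbT.
- case: n_big; rewrite -(ler_nat rat) !natrM /= => H _; rewrite rmorphM /=; lra.
- case: n_big => _; rewrite -(ler_nat rat) natrD !natrM /= => H; rewrite rmorphD !rmorphM /=; lra.
- rewrite VE /alpha /biquad_comb /fst /snd.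
  have -> : GRing.in_alg L (j%:R / 2) = GRing.in_alg L (1 / 2) * j%:R.
    by rewrite -(rmorph_nat (GRing.in_alg L)) -rmorphM; congr (GRing.in_alg L _); field.
  ring.
Qed.
End BiquadraticContradiction.

Section Biquadratic.
Variables (L : fieldExtType rat).

Lemma biquad_ramified_odd (u v w : nat) (X Y Z : L) : biquad_data u v w X Y Z ->
  odd v -> odd w -> (v = w %[mod 4])%N -> (u = v %[mod 4])%N \/ ramified_at_2 u v w.
Proof.
move=> D ov ow vw.
have [x xE] : exists x, v = (2 * x + 1)%N by exists v./2; lia.
have [y yE] : exists y, w = (2 * y + 1)%N by exists w./2; lia.
have sq := biquad_squarefree_uv D.
have [u1|[u0|[u2|u3]]] : (u = v %[mod 4] \/ u = 0 %[mod 4] \/ u = 2 %[mod 4] \/ (u + v = 0 %[mod 4]))%N by lia.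
- by left.
- suff /sq : (2 ^ 2 %| u * v)%N by [].
  by apply: dvdn_mulr; rewrite /dvdn u0.
- right; split; [by exists (Posz x); lia | by exists (Posz y); lia | left].
  by exists (Posz (u %/ 4)); lia.
(* Here u = - v = - w modulo 4, so u v and u w are negatives of odd squares, that is 3 modulo 4. *)
- right; split; [by exists (Posz x); lia | by exists (Posz y); lia | right].
  have [t tE] : exists t : int, Posz v = Posz w + 4 * t by exists (Posz (v %/ 4) - Posz (w %/ 4)); lia.
  have [s sE] : exists s : int, Posz u = 4 * s - Posz v by exists (Posz ((u + v) %/ 4)); lia.
  split.
  + exists (s * w - t * w - Posz y * Posz y - Posz y - 1); rewrite sE tE yE; lia.
  + exists (s * v - Posz x * Posz x - Posz x - 1); rewrite sE xE; lia.
Qed.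

Variables (r : nat) (a : 'I_r -> 'I_r -> int).
Hypotheses (a_pos : pos_def a) (a_univ : universal_over L a).

Lemma biquad_data_not_ramified (u v w : nat) (X Y Z : L) :
  biquad_data u v w X Y Z -> ~ ramified_at_2 u v w.
Proof.
move=> D ram; have [_ _ /eqP vw] := biquad_data_neq D.
have [lt|lt|E] := ltngtP w v; last by case: vw.
  exact: (biquad_not_universal_ramified a_pos a_univ D ram).
apply: (biquad_not_universal_ramified a_pos a_univ (biquad_data_swapYZ D) _ lt).
by case: ram => v1 w1 [u2|[u3 u3']]; split=> //; [left | right].
Qed.

(** An even member of [u], [v], [w] is 2 modulo 4 and, moved to the first place, gives the ramified
    case. If all are odd and no arrangement is ramified, they agree modulo 4, and after sorting the
    unramified case applies. *)
Lemma biquad_data_false (u v w : nat) (X Y Z : L) : ~ biquad_data u v w X Y Z.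
Proof.
move=> D.
have oddP u' v' w' X' Y' Z' (D' : @biquad_data L u' v' w' X' Y' Z') :
    odd v' -> odd w' -> (v' = w' %[mod 4])%N -> (u' = v' %[mod 4])%N.
  move=> ov ow vw; case: (biquad_ramified_odd D' ov ow vw) => // ram.
  by case: (biquad_data_not_ramified D').
have evenP u' v' w' X' Y' Z' (D' : @biquad_data L u' v' w' X' Y' Z') : odd u'.
  apply/negPn/negP => eu.
  have ov : odd v'.
    apply/negPn/negP => ev; have : (2 %| gcdn u' v')%N by rewrite dvdn_gcd !dvdn2 eu.
    by rewrite (eqP (biquad_coprime_uv D')).
  have ow : odd w'.
    apply/negPn/negP => ev; have : (2 %| gcdn u' w')%N by rewrite dvdn_gcd !dvdn2 eu.
    by rewrite (eqP (biquad_coprime_uw D')).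
  have sq := biquad_squarefree_uv D'.
  case: (biquad_data_not_ramified D'); split.
  - by exists (Posz (v' %/ 2)); lia.
  - by exists (Posz (w' %/ 2)); lia.
  - left; exists (Posz (u' %/ 4)).
    have [u0|] : (u' = 0 %[mod 4] \/ u' = 2 %[mod 4])%N by lia.
      suff /sq : (2 ^ 2 %| u' * v')%N by [].
      by apply: dvdn_mulr; rewrite /dvdn u0.
    by lia.
have D1 := biquad_data_swapXY D; have D2 := biquad_data_swapXY (biquad_data_swapYZ D).
have ou := evenP _ _ _ _ _ _ D; have ov := evenP _ _ _ _ _ _ D1.
have ow := evenP _ _ _ _ _ _ D2.
have e1 := oddP _ _ _ _ _ _ D ov ow; have e2 := oddP _ _ _ _ _ _ D1 ou ow.
have e3 := oddP _ _ _ _ _ _ D2 ou ov.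
(* Two of three odd numbers agree modulo 4, and [e1], [e2], [e3] then force the third to agree with
   them. *)
have [uv vw] : (u = v %[mod 4])%N /\ (v = w %[mod 4])%N by lia.
have sqmod x y : odd x -> (x = y %[mod 4])%N -> (x * y = 1 %[mod 4])%N.
  move=> ox xy; rewrite -modnMmr -xy modnMmr.
  have [h ->] : exists h, x = (2 * h + 1)%N by exists (x %/ 2)%N; lia.
  have -> : ((2 * h + 1) * (2 * h + 1) = (h * h + h) * 4 + 1)%N by lia.
  by rewrite modnMDl.
have sorted u' v' w' X' Y' Z' (D' : @biquad_data L u' v' w' X' Y' Z') :
    (u' = v' %[mod 4])%N -> (v' = w' %[mod 4])%N -> odd u' -> odd v' -> odd w' ->
    (w' < v')%N -> (v' < u')%N -> False.
  move=> uv' vw' ou' ov' ow' l1 l2.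
  apply: (biquad_not_universal_unramified a_pos a_univ D' l1 l2).
  - exact: sqmod.
  - by apply: sqmod => //; rewrite uv'.
  - exact: sqmod.
have uw := etrans uv vw.
have [/eqP nuv /eqP nuw /eqP nvw] := biquad_data_neq D.
have D3 := biquad_data_swapYZ D; have D4 := biquad_data_swapYZ D1.
have D5 := biquad_data_swapYZ D2.
have [luv|luv|?] := ltngtP u v; have [luw|luw|?] := ltngtP u w;
have [lvw|lvw|?] := ltngtP v w; try by lia.
- by apply: (sorted _ _ _ _ _ _ D5).
- by apply: (sorted _ _ _ _ _ _ D4).
- by apply: (sorted _ _ _ _ _ _ D1).
- by apply: (sorted _ _ _ _ _ _ D2).
- by apply: (sorted _ _ _ _ _ _ D3).
- by apply: (sorted _ _ _ _ _ _ D).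
Qed.

End Biquadratic.

(** * From two square roots to a biquadratic basis *)

Lemma Fadjoin_quadratic (L : fieldExtType rat) (K : {subfield L}) (b x : L) :
  b * b \in K -> x \in <<K; b>>%VS ->
  exists s t, [/\ s \in K, t \in K & x = s + t * b].
Proof.
move=> bK /Fadjoin_polyP [p /polyOverP pK ->].
pose P z := exists s t, [/\ s \in K, t \in K & z = s + t * b].
have P0 : P 0 by exists 0, 0; rewrite !mem0v mul0r addr0.
have PD y z : P y -> P z -> P (y + z).
  move=> [s [t [sK tK ->]]] [s' [t' [sK' tK' ->]]].
  by exists (s + s'), (t + t'); rewrite !rpredD //; split=> //; ring.
have PX c n : c \in K -> P (c * b ^+ n).
  elim: n c => [|n IH] c cK; first by exists c, 0; rewrite mem0v; split=> //; ring.
  have [s [t [sK tK E]]] := IH c cK; exists (t * (b * b)), s.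
  by rewrite (exprSr b n) (mulrA c) E rpredM //; split=> //; ring.
rewrite horner_coef; elim/big_ind: _ => // i _; exact: PX.
Qed.

Lemma squarefree_irrational (m : nat) (t : rat) :
  squarefree m -> (1 < m)%N -> t * t != m%:R.
Proof.
move=> sqm m_gt1; apply/eqP => tt.
have [||k kE] := @squarefree_rat 1 t.
- by move=> d; rewrite dvdn1 => /eqP; case: d => [|[|d]].
- by exists (Posz m); rewrite mulr1.
have /eqP : (k * k)%:~R = (Posz m)%:~R :> rat by rewrite rmorphM /= -kE.
rewrite eqr_int => /eqP /(congr1 absz); rewrite abszM /= => kk.
have /sqm k1 : (`|k| ^ 2 %| m)%N by rewrite -kk mulnn.
by move: m_gt1; rewrite -kk k1.
Qed.

Lemma squarefree_dvd m n : (m %| n)%N -> squarefree n -> squarefree m.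
Proof. by move=> mn sqn d dm; apply/sqn/(dvdn_trans dm). Qed.

Lemma squarefree_coprimeM m n : (0 < m * n)%N -> coprime m n -> squarefree m -> squarefree n ->
  squarefree (m * n).
Proof.
move=> mn_gt0 cop sqm sqn d dmn; apply/eqP/negPn/negP => d1.
have d_gt0 : (0 < d)%N by case: d dmn {d1} => //; rewrite dvd0n; case: (m * n)%N mn_gt0.
have pr : prime (pdiv d) by apply: pdiv_prime; case: d d1 d_gt0 {dmn} => [|[|]].
have pd : (pdiv d ^ 2 %| m * n)%N by apply: dvdn_trans dmn; rewrite dvdn_exp2r ?pdiv_dvd.
have [pm|pm] := boolP (pdiv d %| m)%N.
- have cpn : coprime (pdiv d ^ 2) n.
    rewrite coprime_pexpl // prime_coprime //; apply/negP => pn.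
    have p1 : pdiv d = 1%N by apply/eqP; rewrite -dvdn1 -(eqP cop) dvdn_gcd pm.
    by move: pr; rewrite p1.
  by move: pd; rewrite Gauss_dvdl // => /sqm p1; move: pr; rewrite p1.
- have cpm : coprime (pdiv d ^ 2) m by rewrite coprime_pexpl // prime_coprime.
  by move: pd; rewrite Gauss_dvdr // => /sqn p1; move: pr; rewrite p1.
Qed.

Lemma squarefreeM_coprime m n : (0 < m * n)%N -> squarefree (m * n) -> coprime m n.
Proof.
move=> mn_gt0 sq; apply/eqP/sq; rewrite -mulnn dvdn_mul ?dvdn_gcdl ?dvdn_gcdr //.
Qed.

Section Independence.
Variables (L : fieldExtType rat) (u v w : nat) (X Y Z : L).
Hypotheses (XX : X * X = (v * w)%:R) (YY : Y * Y = (u * w)%:R) (XY : X * Y = w%:R * Z).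
Hypotheses (vw : forall t : rat, t * t != (v * w)%:R) (uw : forall t : rat, t * t != (u * w)%:R)
  (uv : forall t : rat, t * t != (u * v)%:R) (w_gt0 : (0 < w)%N).

Lemma sqrt_independent (x y : rat) :
  GRing.in_alg L x + GRing.in_alg L y * X = 0 -> x = 0 /\ y = 0.
Proof.
move=> E; have y0 : y = 0.
  apply/eqP/negPn/negP => y0; have /eqP := vw (x / y); apply.
  have : GRing.in_alg L (x * x) = GRing.in_alg L (y * y * (v * w)%:R).
    move/eqP: E; rewrite addr_eq0 => /eqP xE.
    transitivity (GRing.in_alg L x * GRing.in_alg L x); first ring.
    transitivity (GRing.in_alg L y * GRing.in_alg L y * (v * w)%:R); last ring.
    by rewrite xE -XX; ring.
  by move/fmorph_inj => xx; rewrite mulrACA -invfM xx; field.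
by move: E; rewrite y0 rmorph0 mul0r addr0 => /eqP; rewrite fmorph_eq0 => /eqP.
Qed.

(** Since Z = X Y / w, a relation reads A + B X = - (C + D X) Y. Squaring and separating 1 from [X]
    leaves two rational equations whose nonzero solutions would make u w or u v a rational
    square. *)
Lemma biquad_independent t : biquad_comb X Y Z t = 0 -> t = ((0, 0), (0, 0)).
Proof.
case: t => [[A B] [C D0]]; rewrite /biquad_comb /fst /snd => E.
have w0 : (w%:R : rat) != 0 by rewrite pnatr_eq0 -lt0n.
pose D := D0 / w%:R; have D0E : D0 = D * w%:R by rewrite /D divfK.
have [E1 E2] : A * A + (v * w)%:R * (B * B) - (u * w)%:R * (C * C + (v * w)%:R * (D * D)) = 0
    /\ 2 * (A * B - (u * w)%:R * (C * D)) = 0.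
  apply: sqrt_independent.
  have XX' : X * X = GRing.in_alg L (v * w)%:R by rewrite rmorph_nat.
  have YY' : Y * Y = GRing.in_alg L (u * w)%:R by rewrite rmorph_nat.
  move: XX' YY'; set m := (v * w)%:R; set n := (u * w)%:R => XX' YY'.
  pose q := GRing.in_alg L.
  transitivity ((q A + q B * X) ^+ 2 - (q C + q D * X) ^+ 2 * (Y * Y)).
    transitivity (q A ^+ 2 + q B ^+ 2 * (X * X) + 2 * q A * q B * X
      - (q C ^+ 2 + q D ^+ 2 * (X * X) + 2 * q C * q D * X) * (Y * Y)); last ring.
    by rewrite XX' YY' /q; ring.
  rewrite /q {q}.
  have {}E : GRing.in_alg L A + GRing.in_alg L B * X
      = - (GRing.in_alg L C + GRing.in_alg L D * X) * Y.
    have DZ : GRing.in_alg L D0 * Z = GRing.in_alg L D * (X * Y).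
      by rewrite D0E XY; ring.
    by apply/eqP; rewrite -subr_eq0 -E DZ; apply/eqP; ring.
  by rewrite E; ring.
suff [-> -> -> D_0] : [/\ A = 0, B = 0, C = 0 & D = 0] by rewrite D0E D_0 mul0r.
have {}E2 : A * B = (u * w)%:R * (C * D) by lra.
have nz x y m : (forall t : rat, t * t != m) -> x * x = y * y * m -> x = 0 /\ y = 0.
  move=> nsq xy; have y0 : y = 0.
    apply/eqP/negPn/negP => y0; have /eqP := nsq (x / y); apply.
    by rewrite mulrACA -invfM xy; field.
  by move/eqP: xy; rewrite y0 !mul0r mulf_eq0 orbb => /eqP.
have wuv (t : rat) : t * t != (v * w)%:R * (u * w)%:R.
  apply/eqP => tt; have /eqP := uv (t / w%:R); apply.
  by rewrite mulrACA -invfM tt !natrM; field.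
(* Multiplying the first equation by B^2 and replacing A B by u w C D eliminates [A]; the result
   factors. *)
have /eqP : (B * B - D * D * (u * w)%:R) * ((u * w)%:R * (C * C) - B * B * (v * w)%:R) = 0.
  have : B * B * (A * A) = (u * w)%:R * (C * D) * ((u * w)%:R * (C * D)) by rewrite -E2; ring.
  by move/eqP: E1; rewrite subr_eq0 => /eqP; nra.
rewrite mulf_eq0 !subr_eq0 => /orP [] /eqP E3.
- have [B_0 D_0] := nz _ _ _ uw E3.
  have /(nz _ _ _ uw) [-> ->] : A * A = C * C * (u * w)%:R by move: E1; rewrite B_0 D_0; lra.
  by rewrite B_0 D_0.
- have /(nz _ _ _ wuv) [nC_0 B_0] : ((u * w)%:R * C) * ((u * w)%:R * C) = B * B * ((v * w)%:R * (u * w)%:R).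
    by transitivity ((u * w)%:R * ((u * w)%:R * (C * C))); [ring | rewrite E3; ring].
  have C_0 : C = 0.
    move/eqP: nC_0; rewrite mulf_eq0 => /orP [u0|/eqP//].
    by have := uw 0; rewrite mul0r eq_sym u0.
  have /(nz _ _ _ wuv) [-> ->] : A * A = D * D * ((v * w)%:R * (u * w)%:R).
    by move: E1; rewrite B_0 C_0; lra.
  by rewrite B_0 C_0.
Qed.
End Independence.

Lemma not_universal_biquadratic (L : fieldExtType rat) (r : nat) (a : 'I_r -> 'I_r -> int) :
  pos_def a -> real_biquadratic L -> ~ universal_over L a.
Proof.
move=> a_pos [p [q [[p1 q1 pq sqp sqq]]]] [X [Y [XX YY full]]] a_univ.
(* Dividing by the gcd turns p q into w^2 u v, so that X Y / w is a square root of the squarefree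
   number u v. *)
pose w := gcdn p q; pose v := (p %/ w)%N; pose u := (q %/ w)%N.
have w_gt0 : (0 < w)%N by rewrite gcdn_gt0 ltnW.
have pE : (v * w)%N = p by rewrite divnK ?dvdn_gcdl.
have qE : (u * w)%N = q by rewrite divnK ?dvdn_gcdr.
have cuv : coprime u v.
  rewrite /coprime -(eqn_pmul2r w_gt0) mul1n muln_gcdl pE qE gcdnC; exact/eqP.
have vw_gt0 : (0 < v * w)%N by rewrite pE ltnW.
have uw_gt0 : (0 < u * w)%N by rewrite qE ltnW.
have [v_gt0 u_gt0] : (0 < v)%N /\ (0 < u)%N by lia.
have uv_gt1 : (1 < u * v)%N.
  rewrite ltnNge; apply/negP => uv1; case/eqP: pq; rewrite -pE -qE.
  by have [-> ->] : u = 1%N /\ v = 1%N by nia.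
have sqv : squarefree v by apply: squarefree_dvd sqp; rewrite -pE dvdn_mulr.
have squ : squarefree u by apply: squarefree_dvd sqq; rewrite -qE dvdn_mulr.
have squv : squarefree (u * v) by apply: squarefree_coprimeM => //; apply: ltnW.
pose Z : L := w%:R^-1 * (X * Y).
have w_neq0 : (w%:R : L) != 0.
  by rewrite -(rmorph_nat (GRing.in_alg L)) fmorph_eq0 pnatr_eq0 -lt0n.
have XX' : X * X = (v * w)%:R by rewrite pE -expr2.
have YY' : Y * Y = (u * w)%:R by rewrite qE -expr2.
have XY : X * Y = w%:R * Z by rewrite /Z mulrA divff // mul1r.
apply: (@biquad_data_false L _ a a_pos a_univ u v w X Y Z).
have cuw : coprime u w by apply: squarefreeM_coprime => //; rewrite qE.
have cvw : coprime v w by apply: squarefreeM_coprime => //; rewrite pE.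
split=> //; rewrite ?pE ?qE //.
split.
- by rewrite -PoszM.
- by rewrite -PoszM.
- rewrite /Z; transitivity (w%:R^-1 * w%:R^-1 * ((X * X) * (Y * Y))); first ring.
  by rewrite XX' YY' !natrM rmorphM /=; field.
- by [].
- rewrite /Z; transitivity (w%:R^-1 * ((X * X) * Y)); first ring.
  by rewrite XX' natrM; field.
- rewrite /Z; transitivity (w%:R^-1 * ((Y * Y) * X)); first ring.
  by rewrite YY' natrM; field.
- move=> e; have : e \in <<1 & [:: X; Y]>>%VS by rewrite full memvf.
  rewrite adjoin_cons adjoin_seq1.
  have natK (K : {subfield L}) n : (n%:R : L) \in K by rewrite rpred_nat.
  case/Fadjoin_quadratic; first by rewrite YY' natK.
  move=> s [t [sK tK ->]].
  have K1 z : z \in <<1; X>>%VS -> exists x y : rat, z = GRing.in_alg L x + GRing.in_alg L y * X.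
    case/Fadjoin_quadratic; first by rewrite XX' natK.
    by move=> _ [_ [/vlineP [x ->] /vlineP [y ->] ->]]; exists x, y.
  have [A [B ->]] := K1 _ sK; have [C [D ->]] := K1 _ tK.
  exists ((A, B), (C, D * w%:R)); rewrite /biquad_comb /fst /snd.
  by rewrite rmorphM rmorph_nat -[_ * w%:R * Z]mulrA -XY; ring.
- apply: (biquad_independent XX' YY' XY) => //.
  + by move=> t; apply: squarefree_irrational; rewrite pE.
  + by move=> t; apply: squarefree_irrational; rewrite qE.
  + by move=> t; apply: squarefree_irrational.
Qed.

(** * Cubic fields *)

Section CubicCoordinates.
Variables (L : fieldExtType rat).
Let q (c : rat) : L := GRing.in_alg L c.
Hypothesis dimL : \dim {:L} = 3%N.
Variable y : L.
Hypothesis y_irr : y \notin 1%VS.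

Definition cubic_comb (t : rat * rat * rat) : L := q t.1.1 + q t.1.2 * y + q t.2 * (y * y).

Lemma cubic_adjoin_degree : adjoin_degree 1%AS y = 3%N.
Proof.
have : (\dim <<1; y>>%VS %| 3)%N by rewrite -dimL field_dimS ?subvf.
rewrite dim_Fadjoin dimv1 muln1 (dvdn_divisors (adjoin_degree 1 y)) //.
rewrite -[divisors 3]/[:: 1%N; 3%N] !inE => /orP [|/eqP //].
by rewrite adjoin_deg_eq1 (negbTE y_irr).
Qed.

Lemma cubic_span e : exists t, e = cubic_comb t.
Proof.
have e_in : e \in <<1; y>>%VS.
  have -> : <<1; y>>%VS = fullv :> {vspace L}; last exact: memvf.
  apply/eqP; rewrite eqEdim subvf /=.
  by rewrite dimL dim_Fadjoin dimv1 muln1 cubic_adjoin_degree.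
have sz := size_Fadjoin_poly 1%AS y e; rewrite cubic_adjoin_degree in sz.
have /polyOverP c1 := Fadjoin_polyOver 1%AS y e.
rewrite -(Fadjoin_poly_eq e_in) (horner_coef_wide _ sz).
have /vlineP [x0 E0] := c1 0%N; have /vlineP [x1 E1] := c1 1%N.
have /vlineP [x2 E2] := c1 2%N.
exists (x0, x1, x2); rewrite !big_ord_recl big_ord0 /= /bump /= !add1n.
by rewrite E0 E1 E2 /cubic_comb /q /=; rewrite expr0 expr1 expr2 mulr1 addr0 addrA.
Qed.

Lemma cubic_free t : cubic_comb t = 0 -> t = (0, 0, 0).
Proof.
case: t => [[x0 x1] x2] E.
pose p : {poly L} := \poly_(i < 3) nth 0 [:: q x0; q x1; q x2] i.
have p1 : p \is a polyOver 1%AS.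
  apply/polyOverP => i; rewrite coef_poly; case: ifP => [i3|]; last by rewrite mem0v.
  by case: i i3 => [|[|[|]]] //= _; rewrite rpredZ // mem1v.
have sz : (size p <= adjoin_degree 1%AS y)%N by rewrite cubic_adjoin_degree size_poly.
have /eqP p0 : p == 0.
  rewrite -(root_small_adjoin_poly p1 sz); apply/rootP.
  rewrite horner_poly !big_ord_recl big_ord0 /= -[RHS]E /cubic_comb /q /=.
  by rewrite expr0 expr1 expr2 mulr1 addr0 addrA.
have coef i : p`_i = 0 by rewrite p0 coef0.
have := coef 0%N; have := coef 1%N; have := coef 2%N; rewrite !coef_poly /=.
by move=> /eqP; rewrite fmorph_eq0 => /eqP -> /eqP; rewrite fmorph_eq0 => /eqP ->
  /eqP; rewrite fmorph_eq0 => /eqP ->.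
Qed.

Definition cubic_coord e := sval (sig_eqW (cubic_span e)).

Lemma cubic_coordK e : cubic_comb (cubic_coord e) = e.
Proof. by rewrite /cubic_coord; case: sig_eqW. Qed.

Lemma cubic_comb_inj : injective cubic_comb.
Proof.
move=> [[a b] c] [[a' b'] c'] E.
have /cubic_free [] : cubic_comb (a - a', b - b', c - c') = 0.
  move/eqP: E; rewrite -subr_eq0 => /eqP <-; rewrite /cubic_comb /q /fst /snd.
  ring.
by do 3![move/subr0_eq->].
Qed.

Lemma cubic_combK t : cubic_coord (cubic_comb t) = t.
Proof. by apply: cubic_comb_inj; rewrite cubic_coordK. Qed.

Section Embedding.
Variables (a b c : rat) (F : numFieldType) (r : F).
Hypothesis yE : y ^+ 3 = q a * y ^+ 2 + q b * y + q c.
Hypothesis rE : r ^+ 3 = ratr a * r ^+ 2 + ratr b * r + ratr c.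

Lemma cubic_embedding : exists f : {rmorphism L -> F}, forall t,
  f (cubic_comb t) = ratr t.1.1 + ratr t.1.2 * r + ratr t.2 * r ^+ 2.
Proof.
pose g (t : rat * rat * rat) : F := ratr t.1.1 + ratr t.1.2 * r + ratr t.2 * r ^+ 2.
pose f e := g (cubic_coord e).
have fE t : f (cubic_comb t) = g t by rewrite /f cubic_combK.
have fB : zmod_morphism f.
  move=> x z; rewrite -(cubic_coordK x) -(cubic_coordK z) !fE.
  case: (cubic_coord x) (cubic_coord z) => [[x0 x1] x2] [[z0 z1] z2].
  have -> : cubic_comb (x0, x1, x2) - cubic_comb (z0, z1, z2)
      = cubic_comb (x0 - z0, x1 - z1, x2 - z2).
    by rewrite /cubic_comb /q /fst /snd; ring.
  by rewrite fE /g /fst /snd; ring.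
have fM : monoid_morphism f.
  split=> [|x z].
    have -> : (1 : L) = cubic_comb (1, 0, 0).
      by rewrite /cubic_comb /q /fst /snd; ring.
    by rewrite fE /g /=; ring.
  rewrite -(cubic_coordK x) -(cubic_coordK z) !fE.
  case: (cubic_coord x) (cubic_coord z) => [[x0 x1] x2] [[z0 z1] z2].
  (* [m0] to [m4] are the coefficients of the product polynomial; the terms of degree 3 and 4 are
     then reduced by the cubic relation. *)
  pose m0 := x0 * z0; pose m1 := x0 * z1 + x1 * z0.
  pose m2 := x0 * z2 + x1 * z1 + x2 * z0.
  pose m3 := x1 * z2 + x2 * z1; pose m4 := x2 * z2.
  have -> : cubic_comb (x0, x1, x2) * cubic_comb (z0, z1, z2)
      = cubic_comb (m0 + c * m3 + a * c * m4, m1 + b * m3 + (a * b + c) * m4,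
                    m2 + a * m3 + (a ^+ 2 + b) * m4).
    rewrite /cubic_comb /q /fst /snd.
    transitivity (q m0 + q m1 * y + q m2 * y ^+ 2 + q m3 * y ^+ 3 + q m4 * (y ^+ 3 * y)).
      by rewrite /q /m0 /m1 /m2 /m3 /m4; ring.
    transitivity (q m0 + q m1 * y + q m2 * y ^+ 2 + q m3 * y ^+ 3
        + q m4 * (q a * y ^+ 3 + q b * y ^+ 2 + q c * y)).
      by rewrite {2}yE; ring.
    by rewrite yE /q; ring.
  rewrite fE /g /fst /snd.
  transitivity (ratr m0 + ratr m1 * r + ratr m2 * r ^+ 2 + ratr m3 * r ^+ 3
    + ratr m4 * (r ^+ 3 * r)); last by rewrite /m0 /m1 /m2 /m3 /m4; ring.
  transitivity (ratr m0 + ratr m1 * r + ratr m2 * r ^+ 2 + ratr m3 * r ^+ 3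
    + ratr m4 * (ratr a * r ^+ 3 + ratr b * r ^+ 2 + ratr c * r)).
    by rewrite rE; ring.
  by rewrite {4}rE; ring.
pose G : {rmorphism L -> F} := HB.pack f (GRing.isZmodMorphism.Build L F f fB)
  (GRing.isMonoidMorphism.Build L F f fM).
by exists G.
Qed.
End Embedding.
End CubicCoordinates.

Lemma cubic_vieta (F : fieldType) (a b c r1 r2 r3 : F) :
  'X^3 - a%:P * 'X^2 - b%:P * 'X - c%:P = ('X - r1%:P) * ('X - r2%:P) * ('X - r3%:P) ->
  r1 + r2 + r3 = a /\ r1 * r2 + r1 * r3 + r2 * r3 = - b.
Proof.
move=> E.
have {}E : 'X^3 - a%:P * 'X^2 - b%:P * 'X - c%:P = 'X^3 - (r1 + r2 + r3)%:P * 'X^2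
    - (- (r1 * r2 + r1 * r3 + r2 * r3))%:P * 'X - (r1 * r2 * r3)%:P.
  by rewrite E !(polyCD, polyCM, polyCN); ring.
have := congr1 (fun p : {poly F} => p`_2) E; have := congr1 (fun p : {poly F} => p`_1) E.
rewrite !(coefB, coefD, coefN, coefXn, coefCM, coefX, coefC) /=.
rewrite !mulr0 !mulr1 !subr0 !sub0r => /oppr_inj -> /oppr_inj ->.
by rewrite opprK.
Qed.

(** * Trace, discriminant and positivity in a totally real cubic field *)

(** Values in [algR] give access to ordered-field reasoning about conjugates, and rationality of
    [tr] lets the resulting statements descend to Q through [ratr]. *)
Definition is_trace (L : fieldExtType rat) (s1 s2 s3 : {rmorphism L -> algR}) (tr : L -> rat) :=
  forall x, ratr (tr x) = s1 x + s2 x + s3 x.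

Lemma totally_real_cubic_trace (L : fieldExtType rat) : totally_real_cubic L ->
  exists s1 s2 s3 tr, @is_trace L s1 s2 s3 tr.
Proof.
case=> dimL realL.
have [y y_irr] : exists y : L, y \notin 1%VS.
  have : ~~ (fullv <= (1%VS : {vspace L}))%VS.
    by apply/negP => /dimvS; rewrite dimL dimv1.
  by case/subvPn => y _ y1; exists y.
have [[[c b] a] yE] := cubic_span dimL y_irr (y ^+ 3).
have {}yE : y ^+ 3 = GRing.in_alg L a * y ^+ 2 + GRing.in_alg L b * y + GRing.in_alg L c.
  by rewrite yE /cubic_comb /fst /snd; ring.
pose p : {poly algC} := Poly [:: - ratr c; - ratr b; - ratr a; 1].
have pE : p = 'X^3 - (ratr a)%:P * 'X^2 - (ratr b)%:P * 'X - (ratr c)%:P.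
  by rewrite /p /= !cons_poly_def !polyCN; ring.
have pseq : p = [:: - ratr c; - ratr b; - ratr a; 1] :> seq algC.
  by apply: (@PolyK _ 0); rewrite /= oner_neq0.
have sz : size p = 4%N by rewrite pseq.
have lc : lead_coef p = 1 by rewrite lead_coefE sz pseq.
have [rs] := closed_field_poly_normal p; rewrite lc scale1r => rsE.
have : size rs = 3%N.
  by have := sz; rewrite rsE size_prod_XsubC => -[].
case: rs rsE => [|r1 [|r2 [|r3 []]]] // rsE _.
(* Each complex root of [p] defines an embedding into [algC]; total reality makes the root real, and
   the embedding is rebuilt with values in [algR]. *)
have root_real r : r \in [:: r1; r2; r3] -> exists2 z : algR, algRval z = r &
    exists f : {rmorphism L -> algR}, forall t,
      f (cubic_comb y t) = ratr t.1.1 + ratr t.1.2 * z + ratr t.2 * z ^+ 2.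
  move=> r_rs; have : root p r by rewrite rsE root_prod_XsubC.
  move=> /rootP; rewrite pE !(hornerD, hornerN, hornerM, hornerXn, hornerX, hornerC) => pr.
  have rE : r ^+ 3 = ratr a * r ^+ 2 + ratr b * r + ratr c.
    by apply/eqP; rewrite -subr_eq0 -pr; apply/eqP; ring.
  have [f fE] := cubic_embedding dimL y_irr yE rE.
  have r_real : r \is Num.real.
    have := realL f (cubic_comb y (0, 1, 0)); rewrite fE /=.
    by rewrite rmorph0 rmorph1 mul0r mul1r add0r addr0.
  pose z := in_algR r_real; exists z => //.
  apply: (cubic_embedding dimL y_irr yE).
  apply: (fmorph_inj algRval); rewrite rmorphXn 2!rmorphD (rmorphM _ (ratr a)) (rmorphM _ (ratr b)).
  rewrite rmorphXn !fmorph_rat.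
  exact: rE.
have [z1 z1E [s1 s1E]] := root_real r1 (mem_head _ _).
have [|z2 z2E [s2 s2E]] := root_real r2; first by rewrite !inE eqxx orbT.
have [|z3 z3E [s3 s3E]] := root_real r3; first by rewrite !inE eqxx !orbT.
exists s1, s2, s3.
(* By Vieta and Newton, [y] has trace [a] and y^2 has trace a^2 + 2 b. *)
exists (fun x => let t := cubic_coord dimL y_irr x in 3 * t.1.1 + t.1.2 * a + t.2 * (a ^+ 2 + 2 * b)).
move=> x; rewrite -{2 3 4}(cubic_coordK dimL y_irr x).
case: (cubic_coord dimL y_irr x) => [[x0 x1] x2]; rewrite s1E s2E s3E /=.
have [S1 S2] : z1 + z2 + z3 = ratr a /\ z1 * z2 + z1 * z3 + z2 * z3 = - ratr b.
  have := rsE; rewrite pE !big_cons big_nil mulr1 mulrA => /cubic_vieta [e1 e2].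
  split; apply: (fmorph_inj algRval).
    by rewrite fmorph_rat !rmorphD /= z1E z2E z3E.
  by rewrite rmorphN fmorph_rat !rmorphD !rmorphM /= z1E z2E z3E.
transitivity (3 * ratr x0 + ratr x1 * (z1 + z2 + z3)
   + ratr x2 * ((z1 + z2 + z3) ^+ 2 - 2 * (z1 * z2 + z1 * z3 + z2 * z3))); last ring.
by rewrite S1 S2; ring.
Qed.

Section CubicTrace.
Variables (L : fieldExtType rat) (s1 s2 s3 : {rmorphism L -> algR}) (tr : L -> rat).
Hypothesis trE : is_trace s1 s2 s3 tr.
Let q (c : rat) : L := GRing.in_alg L c.

Lemma ratr_algR_inj : injective (ratr : rat -> algR).
Proof. exact: fmorph_inj. Qed.

Lemma rmorph_in_alg (s : {rmorphism L -> algR}) c : s (q c) = ratr c.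
Proof. exact: (fmorph_eq_rat (s \o GRing.in_alg L)). Qed.

Lemma cubic_trB : zmod_morphism tr.
Proof.
move=> x z; apply: ratr_algR_inj.
transitivity (ratr (tr x) - ratr (tr z) : algR); last ring.
by rewrite !trE !rmorphB; ring.
Qed.

Lemma cubic_trD x z : tr (x + z) = tr x + tr z.
Proof.
apply: ratr_algR_inj; transitivity (ratr (tr x) + ratr (tr z) : algR); last ring.
by rewrite !trE !rmorphD; ring.
Qed.

Lemma cubic_trZ c x : tr (q c * x) = c * tr x.
Proof.
apply: ratr_algR_inj; transitivity (ratr c * ratr (tr x) : algR); last ring.
by rewrite !trE !rmorphM !rmorph_in_alg; ring.
Qed.

Lemma cubic_tr1 : tr 1 = 3.
Proof. by apply: ratr_algR_inj; rewrite trE !rmorph1; ring. Qed.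

Lemma cubic_tr_in_alg c : tr (q c) = 3 * c.
Proof. by rewrite -[q c]mulr1 cubic_trZ cubic_tr1 mulrC. Qed.

(** Newton's identities express the elementary symmetric functions of the conjugates by traces,
    which makes them rational by construction. *)
Definition cubic_e2 x := (tr x ^+ 2 - tr (x * x)) / 2.
Definition cubic_e3 x := (tr x ^+ 3 - 3 * tr x * tr (x * x) + 2 * tr (x * x * x)) / 6.

Lemma cubic_e2E x : ratr (cubic_e2 x) = s1 x * s2 x + s1 x * s3 x + s2 x * s3 x.
Proof.
transitivity ((ratr (tr x) ^+ 2 - ratr (tr (x * x))) / 2 : algR).
  by rewrite /cubic_e2; field.
by rewrite !trE !rmorphM; field.
Qed.

Lemma cubic_e3E x : ratr (cubic_e3 x) = s1 x * s2 x * s3 x.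
Proof.
transitivity ((ratr (tr x) ^+ 3 - 3 * ratr (tr x) * ratr (tr (x * x))
  + 2 * ratr (tr (x * x * x))) / 6 : algR).
  by rewrite /cubic_e3; field.
by rewrite !trE !rmorphM; field.
Qed.

Lemma cubic_char x : x ^+ 3 = q (tr x) * x ^+ 2 - q (cubic_e2 x) * x + q (cubic_e3 x).
Proof.
apply: (fmorph_inj s1).
transitivity (ratr (tr x) * s1 x ^+ 2 - ratr (cubic_e2 x) * s1 x + ratr (cubic_e3 x)).
  by rewrite trE cubic_e2E cubic_e3E; ring.
by rewrite -!(rmorph_in_alg s1); ring.
Qed.

Lemma rat_Aint_int (c : rat) : (ratr c : algC) \in Aint -> exists k : int, c = k%:~R.
Proof.
move=> /(Cint_rat_Aint (Crat_rat c)) /intrP [k].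
by rewrite -(rmorph_int ratr) => /fmorph_inj ->; exists k.
Qed.

Lemma in_OK_tr x : in_OK x -> exists k : int, tr x = k%:~R.
Proof.
move=> xI; apply: rat_Aint_int; rewrite -(fmorph_rat algRval) trE !rmorphD.
have xA (s : {rmorphism L -> algR}) : algRval (s x) \in Aint.
  exact: (in_OK_Aint (algRval \o s)).

by rewrite !rpredD.
Qed.

Lemma in_OK_e2 x : in_OK x -> exists k : int, cubic_e2 x = k%:~R.
Proof.
move=> xI; apply: rat_Aint_int; rewrite -(fmorph_rat algRval) cubic_e2E !rmorphD.
have xA (s : {rmorphism L -> algR}) : algRval (s x) \in Aint.
  exact: (in_OK_Aint (algRval \o s)).

by rewrite !rmorphM /= !(rpredD, rpredM).
Qed.

Lemma in_OK_e3 x : in_OK x -> exists k : int, cubic_e3 x = k%:~R.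
Proof.
move=> xI; apply: rat_Aint_int; rewrite -(fmorph_rat algRval) cubic_e3E.
have xA (s : {rmorphism L -> algR}) : algRval (s x) \in Aint.
  exact: (in_OK_Aint (algRval \o s)).

by rewrite !rmorphM /= !rpredM.
Qed.

(* A multiple of the square of the distance of [x] to the rational line in the
   trace metric. *)
Definition cubic_D x := tr x ^+ 2 - 3 * cubic_e2 x.
(** The polar form of [cubic_D], with diagonal 2 [cubic_D]; it vanishes as soon as one argument is
    rational. *)
Definition cubic_polar x z := 3 * tr (x * z) - tr x * tr z.

Lemma cubic_DE x : ratr (cubic_D x) =
  ((s1 x - s2 x) ^+ 2 + (s1 x - s3 x) ^+ 2 + (s2 x - s3 x) ^+ 2) / 2.
Proof.
transitivity (ratr (tr x) ^+ 2 - 3 * ratr (cubic_e2 x) : algR).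
  by rewrite /cubic_D; ring.
by rewrite trE cubic_e2E; field.
Qed.

Lemma cubic_D_ge0 x : 0 <= cubic_D x.
Proof. by rewrite -(ler0q algR) cubic_DE divr_ge0 ?addr_ge0 ?sqr_ge0. Qed.

(** The three conjugates coincide, so each is a third of the rational trace, and embeddings are
    injective. *)
Lemma cubic_D_eq0 x : cubic_D x = 0 -> x \in 1%VS.
Proof.
move=> /(congr1 (ratr : rat -> algR)); rewrite cubic_DE rmorph0 => D0.
have sq12 := sqr_ge0 (s1 x - s2 x); have sq13 := sqr_ge0 (s1 x - s3 x).
have sq23 := sqr_ge0 (s2 x - s3 x).
have /eqP : (s1 x - s2 x) ^+ 2 = 0 by lra.
rewrite sqrf_eq0 subr_eq0 => /eqP E1.
have /eqP : (s1 x - s3 x) ^+ 2 = 0 by lra.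
rewrite sqrf_eq0 subr_eq0 => /eqP E2.
have -> : x = q (tr x / 3); last by rewrite /q memvZ // mem1v.
apply: (fmorph_inj s1); rewrite rmorph_in_alg.
transitivity (ratr (tr x) / 3 : algR); last by field.
by rewrite trE -E1 -E2; field.
Qed.

Lemma in_OK_D x : in_OK x -> exists k : nat, cubic_D x = k%:R.
Proof.
move=> xI; have [t tE] := in_OK_tr xI; have [e eE] := in_OK_e2 xI.
have D_ge0 := cubic_D_ge0 x; have DE : cubic_D x = (t * t - 3 * e)%:~R.
  by rewrite /cubic_D tE eE rmorphB !rmorphM /=; ring.
move: D_ge0; rewrite DE ler0z; case: (t * t - 3 * e) => // k _.
by exists k.
Qed.

Lemma cubic_D_comb a b c x z :
  cubic_D (q a + q b * x + q c * z)
    = b ^+ 2 * cubic_D x + b * c * cubic_polar x z + c ^+ 2 * cubic_D z.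
Proof.
rewrite /cubic_D /cubic_e2 /cubic_polar.
have -> : (q a + q b * x + q c * z) * (q a + q b * x + q c * z)
  = q (a * a) + q (2 * a * b) * x + q (2 * a * c) * z + q (b * b) * (x * x)
    + q (2 * b * c) * (x * z) + q (c * c) * (z * z) by rewrite /q; ring.
by rewrite !cubic_trD !cubic_trZ !cubic_tr_in_alg; field.
Qed.

(** The difference of the two sides is 3 (s2 x - s3 x)^2. This tells which integer shifts of [x] are
    totally positive. *)
Lemma cubic_root_bound x : (3 * s1 x - ratr (tr x)) ^+ 2 <= 4 * ratr (cubic_D x).
Proof.
rewrite cubic_DE trE -subr_ge0.
rewrite (_ : _ - _ = 3 * (s2 x - s3 x) ^+ 2); last by field.
by rewrite mulr_ge0 ?sqr_ge0.
Qed.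

(** The difference of the two sides is 27 times the discriminant of the characteristic polynomial, a
    square of a real number. *)
Lemma cubic_disc x :
  (2 * tr x ^+ 3 - 9 * tr x * cubic_e2 x + 27 * cubic_e3 x) ^+ 2 <= 4 * cubic_D x ^+ 3.
Proof.
rewrite -subr_ge0 -(ler0q algR).
have -> : ratr (4 * cubic_D x ^+ 3
    - (2 * tr x ^+ 3 - 9 * tr x * cubic_e2 x + 27 * cubic_e3 x) ^+ 2)
  = 4 * (ratr (tr x) ^+ 2 - 3 * ratr (cubic_e2 x)) ^+ 3
    - (2 * ratr (tr x) ^+ 3 - 9 * ratr (tr x) * ratr (cubic_e2 x) + 27 * ratr (cubic_e3 x)) ^+ 2 :> algR.
  by rewrite /cubic_D; ring.
rewrite trE cubic_e2E cubic_e3E.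
rewrite (_ : _ - _ = 27 * ((s1 x - s2 x) * (s1 x - s3 x) * (s2 x - s3 x)) ^+ 2); last ring.
by rewrite mulr_ge0 // sqr_ge0.
Qed.

Lemma cubic_totally_positive x : 0 < tr x -> 0 < cubic_e2 x -> 0 < cubic_e3 x ->
  totally_positive x.
Proof. by move=> t e f; apply: totally_positive_cubic t e f (cubic_char x). Qed.

End CubicTrace.

(** * Successive minima of the quotient form and a reduced integral basis *)

Section CubicMinima.
Variables (L : fieldExtType rat) (s1 s2 s3 : {rmorphism L -> algR}) (tr : L -> rat).
Hypothesis trE : is_trace s1 s2 s3 tr.
Let q (c : rat) : L := GRing.in_alg L c.
Let D := cubic_D tr.
Let g := cubic_polar tr.
Hypothesis dimL : \dim {:L} = 3%N.

(** [D] takes natural values on integers of the field, so descent terminates. *)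
Lemma exists_min_D (P : L -> Prop) : (exists x, P x) -> (forall x, P x -> in_OK x) ->
  exists y, P y /\ forall z, P z -> D y <= D z.
Proof.
move=> [x Px] PI; have [n xn] := in_OK_D trE (PI x Px).
elim/ltn_ind: n x Px xn => n IH x Px xn.
have [min|/not_all_ex_not [z Hz]] := classic (forall z, P z -> D x <= D z).
  by exists x.
have [Pz /negP lt] := imply_to_and _ _ Hz; rewrite -ltNge in lt.
have [k kn] := in_OK_D trE (PI z Pz); apply: (IH k _ z Pz kn).
by move: lt; rewrite /D xn kn ltr_nat.
Qed.

Lemma in_alg_vline c : q c \in 1%VS.
Proof. by rewrite /q memvZ ?mem1v. Qed.

Lemma vline_in_alg (x : L) : x \in 1%VS -> exists c, x = q c.
Proof. by case/vlineP => c ->; exists c. Qed.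

Lemma exists_in_OK_irrational : exists x : L, in_OK x /\ x \notin 1%VS.
Proof.
have [y y_irr] : exists y : L, y \notin 1%VS.
  have : ~~ (fullv <= (1%VS : {vspace L}))%VS.
    by apply/negP => /dimvS; rewrite dimL dimv1.
  by case/subvPn => y _ y1; exists y.
have char := cubic_char trE y.
set t := tr y in char; set e := cubic_e2 tr y in char; set f := cubic_e3 tr y in char.
pose N := denq t * denq e * denq f.
have N0 : N != 0 by rewrite !mulf_neq0 ?denq_neq0.
exists (q N%:~R * y); split.
  apply: (@in_OK_cubic L _ (numq t * (denq e * denq f))
     (numq e * (denq t * denq f) * N) (numq f * (denq t * denq e) * N ^+ 2)).
  have qz (k : int) : k%:~R = q k%:~R by rewrite /q rmorph_int.
  have nd (c : rat) : (numq c)%:~R = c * (denq c)%:~R.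
    by rewrite -[X in _ = X * _]divq_num_den divfK // intr_eq0 denq_neq0.
  transitivity (q N%:~R ^+ 3 * (q t * y ^+ 2 - q e * y + q f)).
    by rewrite /q -char; ring.
  have E1 : (numq t * (denq e * denq f))%:~R = t * N%:~R :> rat.
    by rewrite /N !rmorphM /= nd; ring.
  have E2 : (numq e * (denq t * denq f) * N)%:~R = e * N%:~R ^+ 2 :> rat.
    by rewrite /N !rmorphM /= nd; ring.
  have E3 : (numq f * (denq t * denq e) * N ^+ 2)%:~R = f * N%:~R ^+ 3 :> rat.
    by rewrite /N !(rmorphM, rmorphXn) /= nd; ring.
  by rewrite [X in _ = X * _ - _ + _]qz [X in _ = _ - X * _ + _]qz [X in _ = _ + X]qz E1 E2 E3 /q; ring.
have qN0 : q N%:~R != 0 by rewrite fmorph_eq0 intr_eq0.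
apply/negP => /vline_in_alg [c E]; case/negP: y_irr.
have -> : y = q (c / N%:~R); last exact: in_alg_vline.
apply: (mulfI qN0); rewrite E /q -rmorphM; congr GRing.in_alg.
by rewrite mulrCA mulfV ?mulr1 // intr_eq0.
Qed.

Lemma exists_near_int (b : rat) : exists k : int, - (1 / 2) <= b - k%:~R <= 1 / 2.
Proof.
exists (Num.floor (b + 1 / 2)).
have := floor_le (b + 1 / 2); have := lt_succ_floor (b + 1 / 2).
by rewrite rmorphD /= => h1 h2; apply/andP; split; lra.
Qed.

(** [y] and [w] represent the successive minima of [D] on the integers modulo Z: a reduced basis in
    the sense of Lagrange. *)
Record cubic_minima (y w : L) : Prop := CubicMinima {
  minima_y_in : in_OK y;
  minima_y_irr : y \notin 1%VS;
  minima_y_min : forall z, in_OK z -> z \notin 1%VS -> D y <= D z;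
  minima_w_in : in_OK w;
  minima_w_irr : forall a b, w != q a + q b * y;
  minima_w_min : forall z, in_OK z -> (forall a b, z != q a + q b * y) -> D w <= D z
}.

Lemma exists_cubic_minima : exists y w, cubic_minima y w /\ (tr y = 0 \/ tr y = 1).
Proof.
have [|x [xI xirr]|y [[yI yirr] ymin]] := @exists_min_D (fun x => in_OK x /\ x \notin 1%VS).
- exact: exists_in_OK_irrational.
- by [].
have [y' [y'I y'irr DyE tr01]] : exists y', [/\ in_OK y', y' \notin 1%VS, D y' = D y &
    tr y' = 0 \/ tr y' = 1].
  have [t tE] := in_OK_tr trE yI.
  (* The substitutions k + y and k - y preserve [D] and change the trace by a multiple of 3 and a
     sign, so its residue modulo 3 can be made 0 or 1. *)
  have shift (s : rat) (k : int) : s = 1 \/ s = -1 ->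
      let y' := q k%:~R + q s * y in [/\ in_OK y', y' \notin 1%VS, D y' = D y &
      tr y' = 3 * k%:~R + s * t%:~R].
    move=> s1' /=; split.
    - apply: in_OKD; first by rewrite /q rmorph_int; apply: in_OKz.
      by case: s1' => ->; rewrite /q ?rmorphN rmorph1 ?mulN1r ?mul1r //; apply: in_OKN.
    - apply/negP => /vline_in_alg [c E]; case/negP: yirr.
      have -> : y = q (s * (c - k%:~R)); last exact: in_alg_vline.
      have -> : q (s * (c - k%:~R)) = q s * (q c - q k%:~R) by rewrite /q; ring.
      by rewrite -E /q; case: s1' => ->; ring.
    - rewrite (_ : q k%:~R + q s * y = q k%:~R + q s * y + q 0 * y).
        by rewrite /D (cubic_D_comb trE); case: s1' => ->; ring.
      by rewrite /q; ring.
    - by rewrite (cubic_trD trE) (cubic_tr_in_alg trE) (cubic_trZ trE) tE.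
  have [h [hE|[hE|hE]]] : exists h, t = 3 * h \/ t = 3 * h + 1 \/ t = 3 * h + 2.
    by exists (t %/ 3)%Z; lia.
  - have [? ? ? tr'] := shift 1 (- h) (or_introl erefl).
    by eexists; split; try eassumption; left; rewrite tr' hE; ring.
  - have [? ? ? tr'] := shift 1 (- h) (or_introl erefl).
    by eexists; split; try eassumption; right; rewrite tr' hE; ring.
  - have [? ? ? tr'] := shift (-1) (h + 1) (or_intror erefl).
    by eexists; split; try eassumption; right; rewrite tr' hE; ring.
have [|x [xI xirr]|w [[wI wirr] wmin]] :=
    @exists_min_D (fun x => in_OK x /\ forall a b, x != q a + q b * y').
- exists (y' * y'); split; first exact: in_OKM.
  move=> a b; apply/eqP => E.
  have /(cubic_free dimL y'irr) : cubic_comb y' (- a, - b, 1) = 0.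
    by rewrite /cubic_comb /fst /snd E /q; ring.
  by case=> _ _.
- by [].
exists y', w; split=> //; split=> //.
- by move=> z zI zirr; rewrite DyE; apply: ymin.
- by move=> z zI zirr; apply: wmin.
Qed.

End CubicMinima.

Section CubicBasis.
Variables (L : fieldExtType rat) (s1 s2 s3 : {rmorphism L -> algR}) (tr : L -> rat).
Hypothesis trE : is_trace s1 s2 s3 tr.
Let q (c : rat) : L := GRing.in_alg L c.
Let D := cubic_D tr.
Let g := cubic_polar tr.
Hypothesis dimL : \dim {:L} = 3%N.
Variables y w : L.
Hypothesis M : cubic_minima tr y w.

Let y_in : in_OK y := minima_y_in M.
Let y_irr : y \notin 1%VS := minima_y_irr M.
Let w_in : in_OK w := minima_w_in M.

Lemma minima_D_gt0 : 0 < D y.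
Proof.
rewrite lt_def (cubic_D_ge0 trE) andbT; apply/eqP => /(cubic_D_eq0 trE).
by apply/negP; exact: y_irr.
Qed.

Lemma minima_D_le : D y <= D w.
Proof.
apply: (minima_y_min M w_in); apply/negP => /vline_in_alg [c E].
by have /eqP := minima_w_irr M c 0; apply; rewrite E rmorph0 mul0r addr0.
Qed.

(** Minimality of [w] against w + y and w - y. *)
Lemma minima_polar_le : - D y <= g y w <= D y.
Proof.
have key (s : rat) : s = 1 \/ s = -1 -> 0 <= D y + s * g y w.
  move=> s1'; have : D w <= D (q 0 + q s * y + q 1 * w).
    apply: (minima_w_min M).
      rewrite /q rmorph0 rmorph1 add0r mul1r; apply: in_OKD w_in.
      by case: s1' => ->; rewrite ?rmorphN rmorph1 ?mulN1r ?mul1r //; apply: in_OKN.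
    move=> a b; apply/eqP => E; have /eqP := minima_w_irr M a (b - s); apply.
    transitivity (q 0 + q s * y + q 1 * w - q s * y); first by rewrite /q; ring.
    by rewrite E /q; ring.
  rewrite [X in _ <= X](cubic_D_comb trE) -/D -/g; case: s1' => ->; lra.
by have := key 1 (or_introl erefl); have := key (-1) (or_intror erefl); lra.
Qed.

(** Subtracting nearest integers leaves coordinates of absolute value at most 1/2, where [D] is at
    most (D y + |g y w| + D w) / 4 <= 3/4 D w. Minimality of [w] removes the second coordinate, and
    minimality of [y] then removes the first. *)
Lemma minima_basis x : in_OK x -> exists a b c : int,
  x = q a%:~R + q b%:~R * y + q c%:~R * w.
Proof.
move=> xI.
have [[[x0 x1] x2] xE] := cubic_span dimL y_irr x.
have [[[w0 w1] w2] wE] := cubic_span dimL y_irr w.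
have w2_neq0 : w2 != 0.
  apply/eqP => w20; have /eqP := minima_w_irr M w0 w1; apply.
  by rewrite wE w20 /cubic_comb /fst /snd; ring.
pose c := x2 / w2; pose b := x1 - c * w1; pose a := x0 - c * w0.
have {}xE : x = q a + q b * y + q c * w.
  have x2E : x2 = c * w2 by rewrite /c divfK.
  by rewrite xE wE x2E /cubic_comb /a /b /q /fst /snd; ring.
have [k /andP [k1 k2]] := exists_near_int b; have [l /andP [l1 l2]] := exists_near_int c.
have xI' : in_OK (q a + q (b - k%:~R) * y + q (c - l%:~R) * w).
  have -> : q a + q (b - k%:~R) * y + q (c - l%:~R) * w = x - k%:~R * y - l%:~R * w.
    by rewrite xE /q; ring.
  by apply: in_OKB; [apply: in_OKB => // | ]; apply: in_OKM => //; apply: in_OKz.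
have DE := cubic_D_comb trE a (b - k%:~R) (c - l%:~R) y w.
rewrite -/D -/g -/q in DE.
have D_gt0 := minima_D_gt0; have D_le := minima_D_le; have /andP [g1 g2] := minima_polar_le.
set b0 := b - k%:~R in xI' DE k1 k2; set c0 := c - l%:~R in xI' DE l1 l2.
have c0E : c0 = 0.
  apply/eqP/negPn/negP => c0E.
  have : D w <= D (q a + q b0 * y + q c0 * w).
    apply: (minima_w_min M) xI' _ => a' b'; apply/eqP => E.
    have /eqP := minima_w_irr M ((a' - a) / c0) ((b' - b0) / c0); apply.
    have qc0E : q c0 != 0 by rewrite fmorph_eq0.
    apply: (mulfI qc0E); transitivity (q a + q b0 * y + q c0 * w - q a - q b0 * y); first ring.
    rewrite E /q mulrDr mulrA -!rmorphM !(mulrC c0) !divfK //; ring.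
  have bb : b0 ^+ 2 <= 1 / 4 by nra.
  have cc : c0 ^+ 2 <= 1 / 4 by nra.
  have [bc1 bc2] : - (1 / 4) <= b0 * c0 /\ b0 * c0 <= 1 / 4 by split; nra.
  have bcg : b0 * c0 * g y w <= D y / 4 by nra.
  have bbD : b0 ^+ 2 * D y <= D y / 4 by nra.
  have ccD : c0 ^+ 2 * D w <= D w / 4 by nra.
  by rewrite DE; lra.
have b0E : b0 = 0.
  apply/eqP/negPn/negP => b0E.
  have : D y <= D (q a + q b0 * y + q c0 * w).
    apply: (minima_y_min M xI'); apply/negP => /vline_in_alg [c' E].
    have /cubic_free : cubic_comb y (a - c', b0, 0) = 0.
      rewrite /cubic_comb /fst /snd; transitivity (q a + q b0 * y + q c0 * w - q c').
        by rewrite c0E /q; ring.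
      by rewrite E subrr.
    by case/(_ dimL y_irr) => _ /eqP; apply/negP.
  have : b0 ^+ 2 <= 1 / 4 by nra.
  rewrite DE c0E; nra.
move: xI'; rewrite b0E c0E /q !rmorph0 !mul0r !addr0 => /in_OK_rat [m aE].
exists m, k, l; rewrite xE aE.
by rewrite -[b](subrK k%:~R) -[c](subrK l%:~R) -/b0 -/c0 b0E c0E !add0r.
Qed.

Variables (r : nat) (a : 'I_r -> 'I_r -> int).
Hypothesis a_pos : pos_def a.

(** Termwise, 3 tr(x z) = tr x tr z + [cubic_polar] x z, and the polar form ignores rational
    parts. *)
Lemma qf_trace (V : 'I_r -> L) (A B C : 'I_r -> rat) (z x : L) :
  (forall i, V i = q (A i) + q (B i) * z + q (C i) * x) ->
  3 * tr (qf_eval a V) = qf_eval a (fun i => tr (V i)) + 2 * cubic_D tr z * qf_eval a B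
    + cubic_polar tr z x * (qf_eval a (fun i => B i + C i) - qf_eval a B - qf_eval a C)
    + 2 * cubic_D tr x * qf_eval a C.
Proof.
move=> VE.
pose F : {additive L -> rat} :=
  HB.pack tr (GRing.isZmodMorphism.Build L rat tr (cubic_trB trE)).
rewrite -[tr (qf_eval a V)]/(F _) raddf_qf_eval /= /qf_eval.
rewrite !mulrBr !mulr_sumr -!sumrB -!big_split /=.
apply: eq_bigr => i _; rewrite !mulr_sumr -!sumrB -!big_split /=.
apply: eq_bigr => j _; rewrite !VE /cubic_D /cubic_polar /cubic_e2.
have -> : (q (A i) + q (B i) * z + q (C i) * x) * (q (A j) + q (B j) * z + q (C j) * x)
  = q (A i * A j) + q (A i * B j + B i * A j) * z + q (A i * C j + C i * A j) * x
    + q (B i * B j) * (z * z) + q (B i * C j + C i * B j) * (z * x) + q (C i * C j) * (x * x).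
  by rewrite /q; ring.
rewrite !(cubic_trD trE) !(cubic_trZ trE) !(cubic_tr_in_alg trE).
by field.
Qed.

(* [cubic_D] on [Z y + Z w] is a nonnegative combination of [b^2], [c^2] and
   [(b + c)^2] or [(b - c)^2]; the trace of [Q (V)] is, up to the nonnegative
   rational part, the same combination of values of [Q] at integral vectors. *)
Lemma qf_trace_ge (V : 'I_r -> L) (A B C : 'I_r -> int) :
  (forall i, V i = q (A i)%:~R + q (B i)%:~R * y + q (C i)%:~R * w) ->
  (exists i, C i != 0) ->
  2 * D w <= 3 * tr (qf_eval a V).
Proof.
move=> VE [i Ci]; rewrite (qf_trace VE) -/D -/g.
have D_gt0 := minima_D_gt0; have D_le := minima_D_le; have /andP [g1 g2] := minima_polar_le.
have T_ge0 := qf_eval_ge0 a_pos (fun i => tr (V i)).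
pose B' i : rat := (B i)%:~R; pose C' i : rat := (C i)%:~R.
rewrite -/B' -/C'.
have B_ge0 : 0 <= qf_eval a B' := qf_eval_ge0 a_pos _.
have C_ge1 : 1 <= qf_eval a C' := qf_eval_int_ge1 a_pos Ci.
pose S i : rat := B' i + C' i; pose S' i : rat := B' i - C' i.
have parallelogram : qf_eval a S + qf_eval a S' = 2 * (qf_eval a B' + qf_eval a C').
  rewrite /qf_eval mulrDr !mulr_sumr -!big_split /=; apply: eq_bigr => k _.
  rewrite !mulr_sumr -!big_split /=; apply: eq_bigr => l _; rewrite /S /S'; ring.
have S_ge0 : 0 <= qf_eval a S := qf_eval_ge0 a_pos _.
have S'_ge0 : 0 <= qf_eval a S' := qf_eval_ge0 a_pos _.
rewrite -/S.
have intS (E : 'I_r -> int) : (forall i, E i = 0) \/ 1 <= qf_eval a (fun i => (E i)%:~R : rat).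
  have [/existsP [k Ek]|] := boolP [exists k, E k != 0].
    by right; apply: qf_eval_int_ge1 Ek.
  by rewrite negb_exists => /forallP E0; left=> k; apply/eqP/negPn/E0.
(* When [B], B + C or B - C vanishes, the quotient part is Q(C) times 2 D(w), 2 D(w - y) or 2 D(w +
   y), and minimality suffices. *)
have [B0|B_ge1] := intS B.
  have B'0 : qf_eval a B' = 0.
    by rewrite /qf_eval big1 // => k _; rewrite big1 // => l _; rewrite /B' B0 mulr0 mul0r.
  have SC : qf_eval a S = qf_eval a C'.
    by apply: qf_eval_eq => k; rewrite /S /B' B0 add0r.
  by rewrite SC B'0; nra.
rewrite -/B' in B_ge1.
have [BC|S_ge1] := intS (fun i => B i + C i).
  have SE : qf_eval a S = 0.
    rewrite /qf_eval big1 // => k _; rewrite big1 // => l _.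
    by rewrite /S /B' /C' -!rmorphD BC mulr0 mul0r.
  have BE : qf_eval a B' = qf_eval a C'.
    have -> : qf_eval a B' = qf_eval a (fun i => -1 * C' i).
      apply: qf_eval_eq => k; rewrite /B' /C' mulN1r -rmorphN; congr _%:~R.
      by apply/eqP; rewrite -addr_eq0 BC.
    by rewrite qf_eval_scale; ring.
  by rewrite SE BE; nra.
have [BC|S'_ge1] := intS (fun i => B i - C i).
  have SE : qf_eval a S' = 0.
    rewrite /qf_eval big1 // => k _; rewrite big1 // => l _.
    by rewrite /S' /B' /C' -!rmorphB BC mulr0 mul0r.
  have BE : qf_eval a B' = qf_eval a C'.
    by apply: qf_eval_eq => k; rewrite /B' /C'; congr _%:~R; apply/subr0_eq/BC.
  by rewrite SE BE in parallelogram *; nra.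
have {}S_ge1 : 1 <= qf_eval a S.
  apply: le_trans S_ge1 _; rewrite le_eqVlt; apply/orP; left; apply/eqP.
  by apply: qf_eval_eq => k; rewrite rmorphD.
have {}S'_ge1 : 1 <= qf_eval a S'.
  apply: le_trans S'_ge1 _; rewrite le_eqVlt; apply/orP; left; apply/eqP.
  by apply: qf_eval_eq => k; rewrite rmorphB.
(* The weights of Q(B), Q(C) and Q(B + C), or Q(B - C) for negative [g y w], are nonnegative with
   sum 2 D y + 2 D w - |g y w| >= 2 D w, and each of these values is at least 1. *)
have [g0|g0] := leP 0 (g y w); nra.
Qed.

End CubicBasis.

(** * The possible minimal polynomials of the first minimum *)

(** With D = t^2 - 3 e, the last family of bounds compares 2 D with about 6 times the root of D and
    leaves D <= 13; the discriminant then bounds [f]. Each remaining x^3 - t x^2 + e x - f has a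
    negative discriminant, a small integral root, or a totally positive 2 + y or 2 - y of too small
    trace, except for four of discriminant 81 (twice), 148 and 49. *)
Lemma cubic_enumeration (t e f : int) :
  t = 0 \/ t = 1 -> 0 < t * t - 3 * e ->
  (forall k, k * k * k - t * (k * k) + e * k - f != 0) ->
  (forall n s : int, s = 1 \/ s = -1 -> 0 < 3 * n + s * t ->
    0 < 3 * (n * n) + 2 * n * s * t + e ->
    0 < n * n * n + n * n * s * t + n * e + s * f ->
    2 * (t * t - 3 * e) <= 3 * (3 * n + s * t)) ->
  (forall n : int, 0 < n -> 4 * (t * t - 3 * e) < 9 * (n * n) ->
     2 * (t * t - 3 * e) <= 3 * (3 * n + t)) ->
  (2 * (t * t * t) - 9 * t * e + 27 * f) * (2 * (t * t * t) - 9 * t * e + 27 * f)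
    <= 4 * ((t * t - 3 * e) * (t * t - 3 * e) * (t * t - 3 * e)) ->
  (t = 0 /\ e = -3 /\ (f = 1 \/ f = -1)) \/ (t = 1 /\ e = -3 /\ f = -1)
    \/ (t = 1 /\ e = -2 /\ f = -1).
Proof.
move=> t01 D_gt0 noroot bound1 bound2 disc.
have D_le : t * t - 3 * e <= 13.
  have [d dE] : exists d : nat, t * t - 3 * e = Posz d.
    by exists `|(t * t - 3 * e)%R|%N; rewrite gez0_abs // ltW.
  (* [s + 1] is the least positive n with 9 n^2 > 4 d, the smallest shift that the root bound
     certifies. *)
  have [s /andP [s1 s2]] := isqrtP (4 * d %/ 9).
  have : 2 * (t * t - 3 * e) <= 3 * (3 * (Posz s.+1) + t) by apply: bound2; lia.
  have s9 : (9 * (s * s) <= 4 * d)%N by lia.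
  move=> ds; have s_le2 : (s <= 2)%N.
    rewrite leqNgt; apply/negP => s_gt2; have ss : (3 * s <= s * s)%N by rewrite leq_mul2r s_gt2 orbT.
    clear -dE ds s9 s_gt2 ss t01; case: t01 dE ds => -> dE ds; lia.
  clear -dE ds s_le2 t01; case: t01 dE ds => -> dE ds; lia.
have b1 := bound1 2 1 (or_introl erefl); have b2 := bound1 2 (-1) (or_intror erefl).
have r0 := noroot 0; have r1 := noroot 1; have r2 := noroot 2.
have r3 := noroot (-1); have r4 := noroot (-2).
have [x1 x2] : -94 < 2 * (t * t * t) - 9 * t * e + 27 * f
    /\ 2 * (t * t * t) - 9 * t * e + 27 * f < 94.
  have sq_lt (x d : int) : 0 <= d <= 13 -> x * x <= 4 * (d * d * d) -> -94 < x /\ x < 94.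
    move=> /andP [d0 d13] xd; have dd : d * d <= 169 by nia.
    have ddd : d * d * d <= 2197 by nia.
    by split; nia.
  by apply: sq_lt disc; rewrite ltW.
clear bound1 bound2 noroot; move: D_gt0 D_le x1 x2 disc b1 b2 r0 r1 r2 r3 r4.
case: t01 => -> D_gt0 D_le.
- have : e = -1 \/ e = -2 \/ e = -3 \/ e = -4 by lia.
  case=> [->|[->|[->|->]]] x1 x2 disc b1 b2 r0 r1 r2 r3 r4;
  (have [f1 f2] : -6 <= f /\ f <= 6 by (clear -x1 x2; lia));
  (have fE : f = -6 \/ f = -5 \/ f = -4 \/ f = -3 \/ f = -2 \/ f = -1 \/ f = 0
    \/ f = 1 \/ f = 2 \/ f = 3 \/ f = 4 \/ f = 5 \/ f = 6 by (clear -f1 f2; lia));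
  clear f1 f2 D_gt0 D_le x1 x2;
  case: fE => [fE|[fE|[fE|[fE|[fE|[fE|[fE|[fE|[fE|[fE|[fE|[fE|fE]]]]]]]]]]]]; subst f; lia.
- have : e = 0 \/ e = -1 \/ e = -2 \/ e = -3 \/ e = -4 by lia.
  case=> [->|[->|[->|[->|->]]]] x1 x2 disc b1 b2 r0 r1 r2 r3 r4;
  (have [f1 f2] : -6 <= f /\ f <= 6 by (clear -x1 x2; lia));
  (have fE : f = -6 \/ f = -5 \/ f = -4 \/ f = -3 \/ f = -2 \/ f = -1 \/ f = 0
    \/ f = 1 \/ f = 2 \/ f = 3 \/ f = 4 \/ f = 5 \/ f = 6 by (clear -f1 f2; lia));
  clear f1 f2 D_gt0 D_le x1 x2;
  case: fE => [fE|[fE|[fE|[fE|[fE|[fE|[fE|[fE|[fE|[fE|[fE|[fE|fE]]]]]]]]]]]]; subst f; lia.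
Qed.

Section CubicContradiction.
Variables (L : fieldExtType rat) (s1 s2 s3 : {rmorphism L -> algR}) (tr : L -> rat).
Hypothesis trE : is_trace s1 s2 s3 tr.
Let q (c : rat) : L := GRing.in_alg L c.
Let D := cubic_D tr.
Let g := cubic_polar tr.
Hypothesis dimL : \dim {:L} = 3%N.
Variables y w : L.
Hypothesis M : cubic_minima tr y w.
Variables (r : nat) (a : 'I_r -> 'I_r -> int).
Hypotheses (a_pos : pos_def a) (a_univ : universal_over L a).

Let y_in : in_OK y := minima_y_in M.
Let y_irr : y \notin 1%VS := minima_y_irr M.
Let w_in : in_OK w := minima_w_in M.

(** If all [C i] vanish, the y^2-coordinate of Q(V) is Q(B); being 0 it forces B = 0, and Q(V) would
    be rational. This is what brings in the second minimum. *)
Lemma qf_eval_outside_line (V : 'I_r -> L) (A B C : 'I_r -> int) (m s : rat) :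
  (forall i, V i = q (A i)%:~R + q (B i)%:~R * y + q (C i)%:~R * w) ->
  s != 0 -> qf_eval a V = q m + q s * y -> exists i, C i != 0.
Proof.
move=> VE s0 E; have [/existsP //|] := boolP [exists i, C i != 0].
rewrite negb_exists => /forallP C0.
have {}VE i : V i = q (A i)%:~R + q (B i)%:~R * y.
  by rewrite VE (eqP (negPn (C0 i))) /q !rmorph0 mul0r addr0.
move: E; rewrite (qf_eval_eq _ VE) (qf_eval_affine (GRing.in_alg L) a (fun i => (A i)%:~R) (fun i => (B i)%:~R)).
set x0 := qf_eval a _; set x1 := _ - _ - _; set x2 := qf_eval a (fun i => (B i)%:~R) => E.
have /(cubic_free dimL y_irr) [_ x1E x2E] : cubic_comb y (x0 - m, x1 - s, x2) = 0.
  rewrite /cubic_comb /fst /snd.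
  transitivity (q x0 + q x1 * y + q x2 * (y * y) - (q m + q s * y)); first by rewrite /q; ring.
  by rewrite E subrr.
case/eqP: s0; move: x1E => /subr0_eq <-; rewrite /x1.
have B0 := qf_eval_eq0 a_pos x2E.
rewrite -/x2 x2E subr0; apply/eqP; rewrite subr_eq0; apply/eqP.
by apply: qf_eval_eq => i; rewrite B0 addr0.
Qed.

Variables (t e f : int).
Hypotheses (tE : tr y = t%:~R) (eE : cubic_e2 tr y = e%:~R) (fE : cubic_e3 tr y = f%:~R).

Lemma minima_DE : D y = (t * t - 3 * e)%:~R.
Proof. by rewrite /D /cubic_D tE eE rmorphB !rmorphM /=; ring. Qed.

Lemma cubic_eq : y ^+ 3 = q t%:~R * y ^+ 2 - q e%:~R * y + q f%:~R.
Proof. by rewrite -tE -eE -fE; exact: cubic_char trE y. Qed.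

Lemma shift_represented (n s : int) : s = 1 \/ s = -1 ->
  totally_positive (q n%:~R + q s%:~R * y) ->
  exists V A B C, [/\ forall i, V i = q (A i)%:~R + q (B i)%:~R * y + q (C i)%:~R * w,
    exists i, C i != 0 & qf_eval a V = q n%:~R + q s%:~R * y].
Proof.
move=> s1' /a_univ [|V [VI VE]].
  by rewrite /q !rmorph_int; apply: in_OKD; [|apply: in_OKM => //]; apply: in_OKz.
have /fin_all_exists [A /fin_all_exists [B /fin_all_exists [C VE']]] i :=
  minima_basis trE dimL M (VI i).
exists V, A, B, C; split=> //; apply: (qf_eval_outside_line VE' _ VE).
by case: s1' => ->.
Qed.

Lemma tr_shift (n s : int) : tr (q n%:~R + q s%:~R * y) = (3 * n + s * t)%:~R.
Proof.
by rewrite (cubic_trD trE) (cubic_tr_in_alg trE) (cubic_trZ trE) tE rmorphD !rmorphM.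
Qed.

Lemma shift_bound (n s : int) : s = 1 \/ s = -1 ->
  totally_positive (q n%:~R + q s%:~R * y) -> 2 * D w <= 3 * (3 * n + s * t)%:~R.
Proof.
move=> s1' /(shift_represented s1') [V [A [B [C [VE C0 E]]]]].
by rewrite -tr_shift -E; apply: (qf_trace_ge trE M a_pos VE C0).
Qed.

Lemma shift_totally_positive (n s : int) : s = 1 \/ s = -1 ->
  0 < 3 * n + s * t -> 0 < 3 * (n * n) + 2 * n * s * t + e ->
  0 < n * n * n + n * n * s * t + n * e + s * f ->
  totally_positive (q n%:~R + q s%:~R * y).
Proof.
move=> s1' E1 E2 E3; have ss : s%:~R * s%:~R = 1 :> algR by case: s1' => ->; ring.
have tE' : ratr (tr y) = t%:~R :> algR by rewrite tE ratr_int.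
have eE' : ratr (cubic_e2 tr y) = e%:~R :> algR by rewrite eE ratr_int.
have fE' : ratr (cubic_e3 tr y) = f%:~R :> algR by rewrite fE ratr_int.
have sE (s' : {rmorphism L -> algR}) : s' (q n%:~R + q s%:~R * y) = n%:~R + s%:~R * s' y.
  by rewrite rmorphD rmorphM !(rmorph_in_alg s') !ratr_int.
apply: (cubic_totally_positive trE).
- by rewrite tr_shift ltr0z.
- rewrite -(ltr0q algR) (cubic_e2E trE) !sE.
  have -> : (n%:~R + s%:~R * s1 y) * (n%:~R + s%:~R * s2 y) + (n%:~R + s%:~R * s1 y) * (n%:~R + s%:~R * s3 y)
     + (n%:~R + s%:~R * s2 y) * (n%:~R + s%:~R * s3 y)
     = 3 * (n%:~R * n%:~R) + 2 * n%:~R * s%:~R * (s1 y + s2 y + s3 y)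
       + s%:~R * s%:~R * (s1 y * s2 y + s1 y * s3 y + s2 y * s3 y) :> algR by ring.
  rewrite -trE -(cubic_e2E trE) ss tE' eE' mul1r.
  by move: E2; rewrite -(ltr0z algR) !rmorphD !rmorphM.
- rewrite -(ltr0q algR) (cubic_e3E trE) !sE.
  have -> : (n%:~R + s%:~R * s1 y) * (n%:~R + s%:~R * s2 y) * (n%:~R + s%:~R * s3 y)
     = n%:~R * n%:~R * n%:~R + n%:~R * n%:~R * s%:~R * (s1 y + s2 y + s3 y)
       + n%:~R * (s%:~R * s%:~R) * (s1 y * s2 y + s1 y * s3 y + s2 y * s3 y)
       + s%:~R * s%:~R * s%:~R * (s1 y * s2 y * s3 y) :> algR by ring.
  rewrite -trE -(cubic_e2E trE) -(cubic_e3E trE) ss tE' eE' fE' mulr1 mul1r.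
  by move: E3; rewrite -(ltr0z algR) !rmorphD !rmorphM.
Qed.

Lemma large_shift_totally_positive (n : int) : 0 <= t -> 0 < n ->
  4 * (t * t - 3 * e) < 9 * (n * n) -> totally_positive (q n%:~R + q 1%:~R * y).
Proof.
move=> t_ge0 n_gt0 n_big.
have D4 : 4 * ratr (D y) < 9 * (n%:~R * n%:~R) :> algR.
  rewrite minima_DE ratr_int; move: n_big; rewrite -(ltr_int algR).
  by rewrite [X in X < _]rmorphM [X in _ < X]rmorphM [X in _ < _ * X]rmorphM.
have t0 : 0 <= ratr (tr y) :> algR by rewrite tE ratr_int ler0z.
have n0 : 0 < n%:~R :> algR by rewrite ltr0z.
have pos x : (3 * x - ratr (tr y)) ^+ 2 <= 4 * ratr (D y) :> algR -> 0 < n%:~R + x.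
  by move=> H; nra.
have p1 := pos _ (cubic_root_bound trE y).
(* The root bound concerns the first embedding; permuting the embeddings yields the other two
   conjugates. *)
have trE2 : is_trace s2 s1 s3 tr by move=> x; rewrite trE; ring.
have trE3 : is_trace s3 s1 s2 tr by move=> x; rewrite trE; ring.
have p2 := pos _ (cubic_root_bound trE2 y).
have p3 := pos _ (cubic_root_bound trE3 y).
have sE (s' : {rmorphism L -> algR}) : s' (q n%:~R + q 1%:~R * y) = n%:~R + s' y.
  by rewrite rmorphD rmorphM !(rmorph_in_alg s') !ratr_int mul1r.
apply: (cubic_totally_positive trE).
- by rewrite -(ltr0q algR) trE !sE; lra.
- rewrite -(ltr0q algR) (cubic_e2E trE) !sE.
  have := mulr_gt0 p1 p2; have := mulr_gt0 p1 p3; have := mulr_gt0 p2 p3; lra.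
- by rewrite -(ltr0q algR) (cubic_e3E trE) !sE mulr_gt0 ?mulr_gt0.
Qed.

Lemma no_integer_root (k : int) : k * k * k - t * (k * k) + e * k - f != 0.
Proof.
apply/eqP => k0; have kE : f%:~R = k%:~R * k%:~R * k%:~R - t%:~R * (k%:~R * k%:~R) + e%:~R * k%:~R :> rat.
  by rewrite -!(rmorphM, rmorphD, rmorphB) /=; congr _%:~R; move/eqP: k0; rewrite subr_eq0 => /eqP.
have : (y - q k%:~R) * (y * y + q (k%:~R - t%:~R) * y + q (k%:~R * k%:~R - t%:~R * k%:~R + e%:~R)) = 0.
  transitivity (y ^+ 3 - (q t%:~R * y ^+ 2 - q e%:~R * y + q f%:~R)).
    by rewrite kE /q; ring.
  by rewrite cubic_eq subrr.
move/eqP; rewrite mulf_eq0 => /orP [|/eqP E].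
  by rewrite subr_eq0 => /eqP yk; case/negP: y_irr; rewrite yk in_alg_vline.
have /(cubic_free dimL y_irr) : cubic_comb y (k%:~R * k%:~R - t%:~R * k%:~R + e%:~R, k%:~R - t%:~R, 1) = 0.
  by rewrite -[RHS]E /cubic_comb /fst /snd /q; ring.
by case=> _ _.
Qed.

Lemma minima_classification : t = 0 \/ t = 1 ->
  (t = 0 /\ e = -3 /\ (f = 1 \/ f = -1)) \/ (t = 1 /\ e = -3 /\ f = -1)
    \/ (t = 1 /\ e = -2 /\ f = -1).
Proof.
move=> t01; apply: cubic_enumeration => //.
- by have := minima_D_gt0 trE M; rewrite -/D minima_DE ltr0z.
- exact: no_integer_root.
- move=> n s s1' E1 E2 E3.
  have := shift_bound s1' (shift_totally_positive s1' E1 E2 E3).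
  have := minima_D_le M; rewrite -/D minima_DE => h1 h2.
  by rewrite -(ler_int rat) rmorphM [X in _ <= X]rmorphM /=; lra.
- move=> n n_gt0 n_big; have t_ge0 : 0 <= t by case: t01 => ->.
  have := shift_bound (or_introl erefl) (large_shift_totally_positive t_ge0 n_gt0 n_big).
  have := minima_D_le M; rewrite -/D minima_DE mul1r => h1 h2.
  by rewrite -(ler_int rat) rmorphM [X in _ <= X]rmorphM /=; lra.
- have := cubic_disc trE y; rewrite -/D minima_DE tE eE fE => disc.
  rewrite -(ler_int rat); move: disc.
  rewrite !(rmorphM, rmorphD, rmorphB) /=; lra.
Qed.

End CubicContradiction.

(** * The fields of discriminant 148 and 81 *)

Section CubicExceptions.
Variables (L : fieldExtType rat) (s1 s2 s3 : {rmorphism L -> algR}) (tr : L -> rat).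
Hypothesis trE : is_trace s1 s2 s3 tr.
Let q (c : rat) : L := GRing.in_alg L c.
Let D := cubic_D tr.
Let g := cubic_polar tr.
Hypothesis dimL : \dim {:L} = 3%N.
Variables y w : L.
Hypothesis M : cubic_minima tr y w.
Variables (r : nat) (a : 'I_r -> 'I_r -> int).
Hypotheses (a_pos : pos_def a) (a_univ : universal_over L a).

Let y_in : in_OK y := minima_y_in M.
Let y_irr : y \notin 1%VS := minima_y_irr M.
Let w_in : in_OK w := minima_w_in M.

Variables (t e f : int).
Hypotheses (tE : tr y = t%:~R) (eE : cubic_e2 tr y = e%:~R) (fE : cubic_e3 tr y = f%:~R).

Lemma tr_sq : tr (y * y) = (t * t - 2 * e)%:~R.
Proof.
have := eE; rewrite /cubic_e2 tE => E; rewrite rmorphB !rmorphM /=; lra.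
Qed.

Lemma tr_mul_cube (x : L) :
  tr (y * y * y * x) = t%:~R * tr (y * y * x) - e%:~R * tr (y * x) + f%:~R * tr x.
Proof.
have -> : y * y * y * x = q t%:~R * (y * y * x) - q e%:~R * (y * x) + q f%:~R * x.
  transitivity (y ^+ 3 * x); first ring.
  by rewrite (cubic_eq trE tE eE fE) /q; ring.
have trN z : tr (- z) = - tr z.
  have := cubic_trZ trE (-1) z; rewrite rmorphN rmorph1 !mulN1r; exact.
by rewrite !(cubic_trD trE) trN !(cubic_trZ trE).
Qed.

Lemma tr_cube : tr (y * y * y) = t%:~R * (t * t - 2 * e)%:~R - e%:~R * t%:~R + 3 * f%:~R.
Proof.
by rewrite -[y * y * y]mulr1 tr_mul_cube !mulr1 tr_sq tE (cubic_tr1 trE); ring.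
Qed.

Lemma tr_fourth : tr (y * y * (y * y)) = t%:~R * tr (y * y * y) - e%:~R * tr (y * y) + f%:~R * t%:~R.
Proof. by rewrite mulrA tr_mul_cube tE. Qed.

Lemma polar_comb (b0 b c : rat) :
  g y (q b0 + q b * y + q c * w) = 2 * b * D y + c * g y w.
Proof.
rewrite /g /D /cubic_polar /cubic_D /cubic_e2.
have -> : y * (q b0 + q b * y + q c * w) = q b0 * y + q b * (y * y) + q c * (y * w).
  by rewrite /q; ring.
by rewrite !(cubic_trD trE) !(cubic_trZ trE) (cubic_tr_in_alg trE); field.
Qed.

Lemma in_OK_polar x z : in_OK x -> in_OK z -> exists k : int, g x z = k%:~R.
Proof.
move=> xI zI; have [k1 k1E] := in_OK_tr trE xI; have [k2 k2E] := in_OK_tr trE zI.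
have [k3 k3E] := in_OK_tr trE (in_OKM xI zI); exists (3 * k3 - k1 * k2).
by rewrite /g /cubic_polar k1E k2E k3E rmorphB !rmorphM.
Qed.

Lemma square_outside_line (b0 b c : int) :
  y * y = q b0%:~R + q b%:~R * y + q c%:~R * w -> c != 0.
Proof.
move=> E; apply/eqP => c0.
have /(cubic_free dimL y_irr) : cubic_comb y (- b0%:~R, - b%:~R, 1) = 0.
  by rewrite /cubic_comb /fst /snd E c0 /q; ring.
by case=> _ _.
Qed.

(* Both sides are Gram determinants of [y, y^2] and [y, w]; [c] is the index of
   [Z[y]] in the ring of integers. *)
Lemma index_formula : exists b0 b c : int,
  [/\ y * y = q b0%:~R + q b%:~R * y + q c%:~R * w, c != 0 &
    4 * D y * D (y * y) - g y (y * y) ^+ 2 = c%:~R ^+ 2 * (4 * D y * D w - g y w ^+ 2)].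
Proof.
have [b0 [b [c E]]] := minima_basis trE dimL M (in_OKM y_in y_in).
exists b0, b, c; split=> //; first exact: square_outside_line E.
rewrite E polar_comb [D (_ + _)](cubic_D_comb trE) -/D -/g; ring.
Qed.

(* Named after the discriminant of the minimal polynomial of [y]. *)
Lemma exception_148 : t = 1 -> e = -3 -> f = -1 -> False.
Proof.
move=> t1 e3 f1.
have Dy : D y = 10 by rewrite /D (minima_DE tE eE) t1 e3.
have Dw_ge := minima_D_le M; rewrite -/D Dy in Dw_ge.
(* The trace of 2 + y is 7, so 2 D w <= 21; with D y = 10 this pins D w to 10. *)
have tp := shift_totally_positive trE tE eE fE (n := 2) (or_introl erefl).
have Dw_le := shift_bound trE dimL M a_pos a_univ tE (or_introl erefl) (tp _ _ _).
rewrite t1 e3 f1 in Dw_le; have {}Dw_le := Dw_le isT isT isT.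
have [k kE] := in_OK_D trE w_in; rewrite -/D in kE.
have Dw : D w = 10.
  have k_ge : (10 <= k)%N by rewrite -(ler_nat rat); move: Dw_ge; rewrite kE.
  have k_lt : (k < 11)%N by rewrite -(ltr_nat rat); move: Dw_le; rewrite -/D kE; lra.
  by rewrite kE; congr _%:R; lia.
have /andP [g1 g2] := minima_polar_le trE M; rewrite -/D -/g Dy in g1 g2.
have [b0 [b [c [_ c0 E]]]] := index_formula.
have DE : D (y * y) = 16.
  by rewrite /D /cubic_D /cubic_e2 tr_fourth tr_cube tr_sq t1 e3 f1; field.
have gE : g y (y * y) = 14.
  by rewrite /g /cubic_polar mulrA tr_cube tr_sq tE t1 e3 f1; field.
have [l lE] := in_OK_polar y_in w_in; move: g1 g2 E; rewrite DE gE Dy Dw lE.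
rewrite -[10]/(10%:~R : rat) -rmorphN !ler_int => l1 l2 E.
have {}E : 444 = c * c * (400 - l * l).
  apply: (@intr_inj rat); rewrite !(rmorphM, rmorphB) /=.
  by transitivity (4 * 10 * 16 - 14 ^+ 2 : rat); [ring | rewrite E; ring].
have ll : l * l <= 100 by nia.
(* Since 400 - l^2 lies between 300 and 400, c^2 = 1 gives less than 444 and c^2 >= 4 gives more. *)
have [c1|c4] : c * c = 1 \/ 4 <= c * c by nia.
- by rewrite c1 in E; clear -E ll; nia.
- by clear -E ll c4; nia.
Qed.

(** The trace bound for 2 + f y is attained here, so its equality case is analysed: 2 + f y would be
    the square of y^2 + d y - 2 with d = 0 or d = - f, which comparing coordinates refutes. *)
Lemma exception_81 : t = 0 -> e = -3 -> f = 1 \/ f = -1 -> False.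
Proof.
move=> t0 e3 f1.
have ff : f%:~R * f%:~R = 1 :> rat by case: f1 => ->.
have Dy : D y = 9 by rewrite /D (minima_DE tE eE) t0 e3.
have Dw_ge := minima_D_le M; rewrite -/D Dy in Dw_ge.
have tp : totally_positive (q 2%:~R + q f%:~R * y).
  by apply: (shift_totally_positive trE tE eE fE f1); rewrite ?t0 ?e3; case: f1 => ->.
have Dw_le := shift_bound trE dimL M a_pos a_univ tE f1 tp.
have [V [A [B [C [VE [i Ci] VQ]]]]] := shift_represented trE dimL M a_pos a_univ f1 tp.
have Dw : D w = 9.
  by apply/le_anti; rewrite Dw_ge andbT; move: Dw_le; rewrite -/D t0 mulr0 addr0; lra.
have /andP [g1 g2] := minima_polar_le trE M; rewrite -/D -/g Dy in g1 g2.
have [b0 [b [c [yyE c0 E]]]] := index_formula.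
have DE : D (y * y) = 9.
  by rewrite /D /cubic_D /cubic_e2 tr_fourth tr_cube tr_sq t0 e3; field.
have gE : g y (y * y) = 9 * f%:~R.
  by rewrite /g /cubic_polar mulrA tr_cube tr_sq tE t0 e3; field.
have [l lE] := in_OK_polar y_in w_in; move: g1 g2 E; rewrite DE gE Dy Dw lE.
rewrite -[9]/(9%:~R : rat) -rmorphN !ler_int => l1 l2 E.
(* As l^2 <= 81, the second factor is at least 243, so the index is 1 and 1, [y], y^2 form an
   integral basis. *)
have cc : c * c = 1.
  have {}E : 243 = c * c * (324 - l * l).
    apply: (@intr_inj rat); rewrite !(rmorphM, rmorphB) /=.
    transitivity (4 * 9 * 9 - 81 * (f%:~R * f%:~R) : rat); first by rewrite ff; ring.
    by transitivity (4 * 9 * 9 - (9 * f%:~R) ^+ 2 : rat); [ring | rewrite E; ring].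
  have ll : l * l <= 81 by nia.
  have [c1|c4] : c * c = 1 \/ 4 <= c * c by nia.
    by [].
  by clear -E ll c4; nia.
have wE : w = q c%:~R * (y * y - q b0%:~R - q b%:~R * y).
  rewrite yyE; transitivity (q (c * c)%:~R * w); first by rewrite cc /q rmorph1 mul1r.
  by rewrite /q; ring.
pose A' j : rat := (A j - C j * c * b0)%:~R.
pose B' j : rat := (B j - C j * c * b)%:~R.
pose C' j : rat := (C j * c)%:~R.
have {}VE j : V j = q (A' j) + q (B' j) * y + q (C' j) * (y * y).
  by rewrite VE wE /A' /B' /C' /q; ring.
have TQ := qf_trace trE a VE.
rewrite VQ (tr_shift trE tE) t0 -/D -/g Dy DE gE in TQ.
have TV j : tr (V j) = 3 * A' j + 6 * C' j.
  rewrite VE !(cubic_trD trE) (cubic_tr_in_alg trE) !(cubic_trZ trE) tr_sq tE t0 e3.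
  by ring.
have C'i : 1 <= qf_eval a C'.
  apply: (qf_eval_int_ge1 a_pos (v := fun j => C j * c) (i := i)).
  by rewrite mulf_neq0.
have T_ge0 := qf_eval_ge0 a_pos (fun j => tr (V j)).
have SE := qf_eval_addZ a B' C' f%:~R.
set S := qf_eval a (fun j => B' j + f%:~R * C' j) in SE.
have S_ge0 : 0 <= S := qf_eval_ge0 a_pos _.
(* The trace of 2 + f y is 6, and f^2 = 1 gives 2 D(b y + c y^2) = 9 (b^2 + c^2 + (b + f c)^2). *)
have {}TQ : 18 = qf_eval a (fun j => tr (V j)) + 9 * (qf_eval a B' + qf_eval a C' + S).
  rewrite SE expr2 ff; move: TQ; rewrite mulr0 addr0 => TQ.
  by transitivity (3 * (3 * 2)%:~R : rat); [ring | rewrite TQ; ring].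
(* In the equality case every [V j] has trace 0 and equals [C' j] times y^2 + d y - 2, so Q(V) is
   the square of that element because Q(C') = 1. *)
have line_false (d : rat) : qf_eval a C' = 1 -> qf_eval a (fun j => tr (V j)) = 0 ->
    (forall j, B' j = d * C' j) -> False.
  move=> C1 T0 Bd.
  have A0 j : A' j = - 2 * C' j.
    by have := qf_eval_eq0 a_pos T0 j; rewrite TV; lra.
  have : q 2%:~R + q f%:~R * y = (y * y + q d * y - q 2) * (y * y + q d * y - q 2).
    rewrite -VQ (_ : qf_eval a V = qf_eval a (fun j => q (C' j) * (y * y + q d * y - q 2))).
      by rewrite (qf_eval_mull (GRing.in_alg L)) C1 rmorph1 mul1r.
    by apply: qf_eval_eq => j; rewrite VE A0 Bd /q; ring.
  have -> : (y * y + q d * y - q 2) * (y * y + q d * y - q 2)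
      = y ^+ 3 * (y + q (2 * d)) + q (d ^+ 2 - 4) * (y * y) - q (4 * d) * y + q 4.
    by rewrite /q; ring.
  rewrite (cubic_eq trE tE eE fE) t0 e3 => E'.
  have /(cubic_free dimL y_irr) [_ d0 dd] :
      cubic_comb y (2 * d * f%:~R + 2, 2 * d, d ^+ 2 - 1) = 0.
    rewrite /cubic_comb /fst /snd.
    transitivity (q 2%:~R + q f%:~R * y - (q 2%:~R + q f%:~R * y)); last by rewrite subrr.
    by rewrite {1}E' /q; ring.
  have d_0 : d = 0 by lra.
  by move: dd; rewrite d_0 expr0n.
have intB (E' : 'I_r -> int) : (forall j, E' j = 0) \/ 1 <= qf_eval a (fun j => (E' j)%:~R : rat).
  have [/existsP [k Ek]|] := boolP [exists k, E' k != 0].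
    by right; apply: qf_eval_int_ge1 Ek.
  by rewrite negb_exists => /forallP E0; left=> k; apply/eqP/negPn/E0.
have [B0|B_ge1] := intB (fun j => B j - C j * c * b).
  have Bd j : B' j = 0 * C' j by rewrite /B' B0 mul0r.
  have B'0 : qf_eval a B' = 0.
    by rewrite (qf_eval_eq a Bd) qf_eval_scale expr0n mul0r.
  have SC : S = qf_eval a C'.
    transitivity (qf_eval a (fun j => f%:~R * C' j)).
      by apply: qf_eval_eq => j; rewrite Bd mul0r add0r.
    by rewrite qf_eval_scale expr2 ff mul1r.
  by apply: (line_false 0 _ _ Bd); lra.
have {}B_ge1 : 1 <= qf_eval a B' := B_ge1.
have [S0|S_ge1] := intB (fun j => B j - C j * c * b + f * (C j * c)).
  have Bd j : B' j = - f%:~R * C' j.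
    have : (B j - C j * c * b + f * (C j * c))%:~R = 0 :> rat by rewrite S0.
    by rewrite rmorphD rmorphM -/(B' j) -/(C' j); lra.
  have BC : qf_eval a B' = qf_eval a C'.
    by rewrite (qf_eval_eq a Bd) qf_eval_scale sqrrN expr2 ff mul1r.
  by apply: (line_false (- f%:~R) _ _ Bd); lra.
have {}S_ge1 : 1 <= S.
  rewrite (_ : S = qf_eval a (fun j => (B j - C j * c * b + f * (C j * c))%:~R)) //.
  by apply: qf_eval_eq => j; rewrite rmorphD [in RHS]rmorphM.
(* Three nonzero values would contribute at least 27, more than the available 18. *)
have big : 9 * 3 <= 9 * (qf_eval a B' + qf_eval a C' + S).
  by rewrite ler_pM2l // (_ : 3 = 1 + 1 + 1 :> rat) // !lerD.
have := lerD T_ge0 big; rewrite -TQ; lra.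
Qed.

End CubicExceptions.

(** * The field of discriminant 49 *)

Section RealSubfieldZeta7.
Variables (L : fieldExtType rat) (s : {rmorphism L -> algC}) (y : L).
Hypotheses (dimL : \dim {:L} = 3%N) (y_irr : y \notin 1%VS).
Hypothesis yE : y ^+ 3 = y ^+ 2 + 2 * y - 1.

(** The image of - y is a root of x^3 + x^2 - 2 x - 1, the minimal polynomial of the sum of a
    primitive seventh root of unity and its inverse; that root of unity is recovered by solving z^2
    - c z + 1 = 0. *)
Lemma iso_Q_zeta7_plus_of_root : iso_Q_zeta7_plus L.
Proof.
pose c : algC := - s y.
have sy : s y = - c by rewrite opprK.
have cE : c ^+ 3 + c ^+ 2 - 2 * c - 1 = 0.
  have : s y ^+ 3 = s y ^+ 2 + 2 * s y - 1.
    by rewrite -[LHS]rmorphXn yE /=; ring.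
  rewrite sy => E; transitivity (- ((- c) ^+ 3 - ((- c) ^+ 2 + 2 * (- c) - 1))); first ring.
  by rewrite E subrr oppr0.
pose d := sqrtC (c ^+ 2 - 4); have dd : d ^+ 2 = c ^+ 2 - 4 by rewrite sqrtCK.
pose z := (c + d) / 2.
have zz : z * z = c * z - 1.
  transitivity ((c ^+ 2 + 2 * c * d + d ^+ 2) / 4); first by rewrite /z; field.
  by rewrite dd /z; field.
have z0 : z != 0.
  by apply/eqP => z0; move/eqP: zz; rewrite z0 !mulr0 sub0r eq_sym oppr_eq0 oner_eq0.
have zc : z + z^-1 = c.
  apply: (mulfI z0); rewrite mulrDr mulfV // zz; ring.
have z7 : z ^+ 7 = 1.
  apply/eqP; rewrite -subr_eq0; apply/eqP.
  (* With c = z + 1/z, z^3 (c^3 + c^2 - 2 c - 1) is the seventh cyclotomic polynomial 1 + z + ... +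
     z^6. *)
  transitivity ((z - 1) * (z ^+ 3 * ((z + z^-1) ^+ 3 + (z + z^-1) ^+ 2 - 2 * (z + z^-1) - 1))).
    by field.
  by rewrite zc cE !mulr0.
have z1 : z != 1.
  apply/eqP => z1; move: zc cE; rewrite z1 invr1 => <- /eqP.
  rewrite (_ : _ - 1 = 7%:R); last ring.
  by rewrite pnatr_eq0.
have [m m_prim] := prim_order_exists (isT : (0 < 7)%N) z7.
rewrite (dvdn_divisors m) // -[divisors 7]/[:: 1%N; 7%N] !inE => /orP [] /eqP mE.
  by case/eqP: z1; have := prim_expr_order m_prim; rewrite mE expr1.
exists z; split; first by rewrite -mE.
have salg x : s (GRing.in_alg L x) = ratr x by exact: (fmorph_eq_rat (s \o GRing.in_alg L)).
exists s; rewrite zc; split=> [x|_ [p ->]].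
- have [[[x0 x1] x2] ->] := cubic_span dimL y_irr x.
  exists (x0%:P - x1%:P * 'X + x2%:P * ('X * 'X)).
  rewrite !(rmorphD, rmorphN, rmorphM) /= !map_polyX !map_polyC /=.
  rewrite !(hornerD, hornerN, hornerM, hornerX, hornerC) /cubic_comb /fst /snd.
  transitivity (ratr x0 + ratr x1 * s y + ratr x2 * (s y * s y)).
    by rewrite -!salg; ring.
  by rewrite sy; ring.
- exists (map_poly (GRing.in_alg L) p).[- y].
  rewrite -horner_map rmorphN -/c -map_poly_comp; congr (_.[_]).
  by apply: eq_map_poly => x; rewrite /= -salg.
Qed.

End RealSubfieldZeta7.

Lemma not_universal_cubic (L : fieldExtType rat) (r : nat) (a : 'I_r -> 'I_r -> int) :
  pos_def a -> totally_real_cubic L -> ~ iso_Q_zeta7_plus L -> ~ universal_over L a.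
Proof.
move=> a_pos cubicL not7 a_univ; have [dimL _] := cubicL.
have [s1 [s2 [s3 [tr trE]]]] := totally_real_cubic_trace cubicL.
have [y [w [M try]]] := exists_cubic_minima trE dimL.
have y_in := minima_y_in M.
have [t tE] := in_OK_tr trE y_in; have [e eE] := in_OK_e2 trE y_in.
have [f fE] := in_OK_e3 trE y_in.
have t01 : t = 0 \/ t = 1.
  case: try => tr01; [left | right]; apply: (@intr_inj rat); by rewrite -tE tr01.
have [[t0 [e3 f1]]|[[t1 [e3 f1]]|[t1 [e2 f1]]]] :=
  minima_classification trE dimL M a_pos a_univ tE eE fE t01.
- exact: (exception_81 trE dimL M a_pos a_univ tE eE fE).
- exact: (exception_148 trE dimL M a_pos a_univ tE eE fE).
- apply: not7; apply: (iso_Q_zeta7_plus_of_root (algRval \o s1) dimL (minima_y_irr M)).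
  rewrite (cubic_eq trE tE eE fE) t1 e2 f1; ring.
Qed.

Theorem theorem1p2 (L : fieldExtType rat) :
  (totally_real_cubic L \/ real_biquadratic L) ->
  ~ iso_Q_zeta7_plus L ->
  ~ (exists (r : nat) (a : 'I_r -> 'I_r -> int), is_Z_form a /\ universal_over L a).
Proof.
move=> [cubicL|biquadL] not7 [r [a [a_pos a_univ]]].
  exact: not_universal_cubic a_pos cubicL not7 a_univ.
exact: not_universal_biquadratic a_pos biquadL a_univ.
Qed.
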